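(* Let $A$ be a well-ordered alphabet of order type $\omega$ and let $\mathrm{BF}(\omega)$ be the big free group on $A$, with associated $\mathbb Z^\omega$-tree $T(\mathrm{BF}(\omega))$. Let a triple $(w,a^p,t)$ with $w\in\mathrm{BF}(\omega)$, $a\in A$, $p\in\{1,-1\}$, $t\in\mathbb Z^\omega$, $0\le t<L(a)$, and $w$ not ending in the letter $a^{-p}$, represent the element $\langle L(w)+t,\,wa^p\rangle$ of $T(\mathrm{BF}(\omega))$; when $t=0$ the second coordinate is dropped, and the triple is just written $w$ (it represents the point $w=\langle L(w),w\rangle$). Then every element of $T(\mathrm{BF}(\omega))$ has exactly one such representation. In terms of it, the action of $u\in\mathrm{BF}(\omega)$ on $T(\mathrm{BF}(\omega))$ is given by $u\cdot w=uw$ when $t=0$, and for $t>0$ by $$u\cdot(w,a^p,t)=(uw,a^p,t)\quad\text{if } uw \text{ does not end in } a^{-p},$$ $$u\cdot(w,a^p,t)=(uwa^p,a^{-p},L(a)-t)\quad\text{if } uw\text{ ends in }a^{-p}.$$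
   Context: **Big free groups.** Let $A^{-1}$ be a set of formal inverses of $A$, disjoint from $A$, with $(a^{-1})^{-1}=a$. A transfinite word is a function $w:S\to A\cup A^{-1}$ with $S$ totally ordered and $w^{-1}(\{x\})$ finite for every $x\in A\cup A^{-1}$. Words $w_1:S_1\to A\cup A^{-1}$, $w_2:S_2\to A\cup A^{-1}$ are identified if there is an order-preserving bijection $\phi:S_1\to S_2$ with $w_2\circ\phi=w_1$. A cancellation of $w$ is a subset $T\subset S$ with an involution $*:T\to T$ such that for each $t\in T$: the interval of $S$ with endpoints $t$ and $t^*$ is contained in $T$; this interval is mapped onto itself by $*$; and $w(t^* )=w(t)^{-1}$. Then the restriction of $w$ to $S\setminus T$ is said to arise from $w$ by the cancellation; the equivalence relation on words generated by this relation is used. A word is reduced if it admits no nonempty cancellation; each equivalence class contains exactly one reduced word (up to identification). $\mathrm{BF}(\omega)$ is the group of equivalence classes (equivalently, of reduced words) under concatenation, with inverse $w^{-1}$ obtained by reversing the order of $S$ and inverting each letter. An element of $\mathrm{BF}(\omega)$ with reduced form $w:S\to A\cup A^{-1}$ ends in the letter $x$ if $S$ has a last element and $w$ takes the value $x$ there. **Order and length.** $\mathbb Z^\omega=\prod_{a\in A}\mathbb Z$ has the lexicographic order: $(s_a)<(t_a)$ iff there is $a\in A$ with $s_a<t_a$ and $s_b=t_b$ for all $b<a$. For $w\in\mathrm{BF}(\omega)$, $L(w)=(n_a)_{a\in A}\in\mathbb Z^\omega$, where $n_a$ is the number of occurrences of $a$ and $a^{-1}$ in the reduced form of $w$; $c(g,h)=\frac12(L(g)+L(h)-L(g^{-1}h))$,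 which lies in $\mathbb Z^\omega$. **The tree and the action.** With $\Lambda=\mathbb Z^\omega$ and $[a,b]_\Lambda=\{x\in\Lambda:a\le x\le b\}$, $T(\mathrm{BF}(\omega))$ is the disjoint union of the intervals $[0,L(g)]_\Lambda$, $g\in\mathrm{BF}(\omega)$, with $n\in[0,L(g)]_\Lambda$ and $n\in[0,L(h)]_\Lambda$ identified if $n\le c(g,h)$; the class of $n\in[0,L(g)]_\Lambda$ is denoted $\langle n,g\rangle$. The $\Lambda$-valued metric is $d(\langle n,g\rangle,\langle m,h\rangle)=n+m-2\min\{n,m,c(g,h)\}$. A segment is the image of a distance-preserving map from some $[a,b]_\Lambda$ (with metric $|x-y|$), its endpoints being the images of $a$ and $b$; $T(\mathrm{BF}(\omega))$ is a $\Lambda$-tree, in which any two points $x,y$ are the endpoints of a unique segment $[x,y]$. An element $g\in\mathrm{BF}(\omega)$ is regarded as the point $\langle L(g),g\rangle$. The action of $\mathrm{BF}(\omega)$: $h$ sends $\langle n,g\rangle$ to the point of the segment $[h,hg]$ at distance $n$ from $h$. *)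

(* Defs.v *)
From HB Require Import structures.
From mathcomp Require Import all_boot all_order all_algebra finmap.
From mathcomp Require Import mathcomp_extra boolp classical_sets functions.
From mathcomp Require Import cardinality.
From Stdlib Require Import Relation_Operators.

Set Implicit Arguments.
Unset Strict Implicit.
Unset Printing Implicit Defensive.

Import Order.TTheory GRing.Theory Num.Theory.

Local Open Scope classical_set_scope.
Local Open Scope quotient_scope.

Record omegaAlphabet := OmegaAlphabet {
  alph_disp : Order.disp_t;
  alph :> orderType alph_disp;
  alph_omega : exists e : nat -> alph,
    bijective e /\ {mono e : i j / (i <= j)%N >-> (i <= j)%O} }.

Lemma alph_least (A : omegaAlphabet) (P : A -> Prop) :
  (exists a, P a) -> exists2 a, P a & forall b, (b < a)%O -> ~ P b.
Proof.
have [e [[f eK fK] emono]] := alph_omega A; case=> a Pa.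
have exn : exists n, `[< P (e n) >].
  by exists (f a); apply/asboolP; rewrite fK.
case: (ex_minnP exn) => n /asboolP Pn minn.
exists (e n) => // b ltb Pb.
have /minn : `[< P (e (f b)) >] by apply/asboolP; rewrite fK.
by rewrite -emono fK leNgt ltb.
Qed.

(* [(a, false)] is the letter [a] and [(a, true)] its formal inverse, so that
   [(a, p)] stands for [a ^ ((-1) ^ p)] and [(a, ~~ p)] for its inverse. *)
Definition letter (A : Type) : Type := (A * bool)%type.

Definition linv (A : Type) (x : letter A) : letter A := (x.1, ~~ x.2).

(* The domain is not bundled as an [orderType] because that would put [word A]
   in a universe too large for it to be an [eqType]. *)
Record word (A : Type) := Word {
  wdom : Type;
  wle : rel wdom;
  wlab :> wdom -> letter A;
  wle_anti : antisymmetric wle;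
  wle_trans : transitive wle;
  wle_total : total wle;
  wfin : forall x : letter A, finite_set (wlab @^-1` [set x]) }.

HB.instance Definition _ (A : Type) := gen_eqMixin (word A).
HB.instance Definition _ (A : Type) := gen_choiceMixin (word A).

Definition word_iso (A : Type) (w1 w2 : word A) : Prop :=
  exists phi : wdom w1 -> wdom w2,
    [/\ bijective phi,
        {mono phi : s t / @wle A w1 s t >-> @wle A w2 s t} &
        forall s, w2 (phi s) = w1 s].

Definition between (A : Type) (w : word A) (s t : wdom w) : set (wdom w) :=
  [set r | wle s r && wle r t || wle t r && wle r s].

(* Only the values of [star] on [T] matter. *)
Definition cancellation (A : Type) (w : word A)
    (T : set (wdom w)) (star : wdom w -> wdom w) : Prop :=
  (forall t, T t -> T (star t) /\ star (star t) = t) /\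
  (forall t, T t ->
     [/\ between t (star t) `<=` T,
         star @` between t (star t) = between t (star t) &
         w (star t) = linv (w t)]).

Section Restriction.
Context (A : Type) (w : word A) (U : set (wdom w)).

Definition wrestrict_le : rel {s | U s} := fun s t => wle (sval s) (sval t).

Lemma sval_inj : injective (@sval _ U).
Proof.
case=> s Us [t Ut] /= st; rewrite -st in Ut *.
by rewrite (Prop_irrelevance Us Ut).
Qed.

Lemma wrestrict_anti : antisymmetric wrestrict_le.
Proof. by move=> s t /wle_anti; apply: sval_inj. Qed.

Lemma wrestrict_trans : transitive wrestrict_le.
Proof. by move=> s t r; apply: wle_trans. Qed.

Lemma wrestrict_total : total wrestrict_le.
Proof. by move=> s t; apply: wle_total. Qed.

Lemma wrestrict_fin (x : letter A) :
  finite_set ((fun s : {s | U s} => w (sval s)) @^-1` [set x]).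
Proof.
apply: (@finite_preimage _ _ (w @^-1` [set x]) (@sval _ U)).
  by move=> ? ? _ _; apply: sval_inj.
exact: wfin.
Qed.

Definition wrestrict : word A :=
  Word wrestrict_anti wrestrict_trans wrestrict_total wrestrict_fin.

End Restriction.

Definition arises (A : Type) (w v : word A) : Prop :=
  exists (T : set (wdom w)) (star : wdom w -> wdom w),
    cancellation T star /\ word_iso v (wrestrict (~` T)).

Definition word_equiv (A : Type) : word A -> word A -> Prop :=
  clos_refl_sym_trans (word A) (@arises A).

Definition reduced (A : Type) (w : word A) : Prop :=
  forall T star, @cancellation A w T star -> T = set0.

Definition wempty_lab (A : Type) (i : void) : letter A := of_void _ i.

Lemma wempty_fin (A : Type) (x : letter A) :
  finite_set (@wempty_lab A @^-1` [set x]).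
Proof. exact: finite_finset. Qed.

Definition wempty (A : Type) : word A.
Proof.
by refine (@Word A void (fun _ _ => true) _ _ _ _ (@wempty_fin A)); case.
Defined.

Lemma wletter_fin (A : Type) (y x : letter A) :
  finite_set ((fun _ : unit => y) @^-1` [set x]).
Proof. exact: finite_finset. Qed.

Definition wletter (A : Type) (y : letter A) : word A.
Proof.
by refine (@Word A unit (fun _ _ => true) _ _ _ _ (wletter_fin y)) => // -[] [].
Defined.

Section Concatenation.
Context (A : Type) (w1 w2 : word A).

Definition wcat_le : rel (wdom w1 + wdom w2) := fun s t =>
  match s, t with
  | inl s, inl t => wle s t
  | inl _, inr _ => true
  | inr _, inl _ => false
  | inr s, inr t => wle s t
  end.

Definition wcat_lab (s : wdom w1 + wdom w2) : letter A :=
  match s with inl s => w1 s | inr s => w2 s end.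

Lemma wcat_anti : antisymmetric wcat_le.
Proof. by case=> s [] t //= /wle_anti ->. Qed.

Lemma wcat_trans : transitive wcat_le.
Proof. by case=> s [] t [] r //=; apply: wle_trans. Qed.

Lemma wcat_total : total wcat_le.
Proof. by case=> s [] t //=; apply: wle_total. Qed.

Lemma wcat_fin (x : letter A) : finite_set (wcat_lab @^-1` [set x]).
Proof.
apply: (@sub_finite_set _ _ ((inl @` (w1 @^-1` [set x])) `|`
                             (inr @` (w2 @^-1` [set x])))).
  by case=> s /= ws; [left | right]; exists s.
by rewrite finite_setU; split; apply: finite_image; apply: wfin.
Qed.

Definition wcat : word A := Word wcat_anti wcat_trans wcat_total wcat_fin.

End Concatenation.

Lemma linvK (A : Type) : involutive (@linv A).
Proof. by case=> a p; rewrite /linv /= negbK. Qed.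

Section Inverse.
Context (A : Type) (w : word A).

Definition winv_le : rel (wdom w) := fun s t => wle t s.

Lemma winv_anti : antisymmetric winv_le.
Proof. by move=> s t; rewrite andbC => /wle_anti. Qed.

Lemma winv_trans : transitive winv_le.
Proof. by move=> s t r ts sr; apply: wle_trans ts. Qed.

Lemma winv_total : total winv_le.
Proof. by move=> s t; apply: wle_total. Qed.

Lemma winv_fin (x : letter A) :
  finite_set ((fun s => linv (w s)) @^-1` [set x]).
Proof.
apply: (@sub_finite_set _ _ (w @^-1` [set linv x])); last exact: wfin.
by move=> s /= <-; rewrite linvK.
Qed.

Definition winv : word A := Word winv_anti winv_trans winv_total winv_fin.

End Inverse.

Lemma arises_embed (A : Type) (w v : word A) (T : set (wdom w))
    (star : wdom w -> wdom w) (f : wdom v -> wdom w) :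
    cancellation T star ->
    {mono f : s t / @wle A v s t >-> @wle A w s t} ->
    (forall s, w (f s) = v s) -> range f = ~` T ->
  arises w v.
Proof.
move=> canT fmono flab frange; exists T, star; split=> //.
have fT s : (~` T) (f s) by rewrite -frange; exists s.
have finj : injective f.
  move=> s t fst; apply: (@wle_anti _ v); rewrite -!fmono fst.
  by have := @wle_total _ w (f t) (f t); rewrite orbb => ->.
have ginv (r : {r | (~` T) r}) : exists s, f s = sval r.
  have [s _ fs] : range f (sval r) by rewrite frange; apply: svalP.
  by exists s.
exists (fun s => exist _ (f s) (fT s)); split=> //.
exists (fun r => sval (cid (ginv r))) => [s | r].
  by apply: finj; case: cid.
by apply: sval_inj => /=; case: cid.
Qed.

Lemma arisesE (A : Type) (w v : word A) : arises w v ->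
  exists (T : set (wdom w)) (star : wdom w -> wdom w) (f : wdom v -> wdom w),
    [/\ cancellation T star,
        {mono f : s t / @wle A v s t >-> @wle A w s t},
        forall s, w (f s) = v s & range f = ~` T].
Proof.
case=> T [star [canT [phi [[psi phiK psiK] phimono philab]]]].
exists T, star, (fun s => sval (phi s)); split=> //.
apply/seteqP; split=> [_ [s _ <-] | r Tr].
  exact: svalP (phi s).
by exists (psi (exist _ r Tr)) => //; rewrite psiK.
Qed.

Lemma cancellation0 (A : Type) (w : word A) : @cancellation A w set0 id.
Proof. by split. Qed.

Lemma iso_equiv (A : Type) (w v : word A) (f : wdom v -> wdom w) :
    {mono f : s t / @wle A v s t >-> @wle A w s t} ->
    (forall s, w (f s) = v s) -> (forall r, exists s, f s = r) ->
  word_equiv w v.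
Proof.
move=> fmono flab fsurj; apply: rst_step.
apply: (arises_embed (@cancellation0 A w) fmono flab).
by apply/seteqP; split=> [? _ [] | r _]; have [s <-] := fsurj r; exists s.
Qed.

Lemma arises_catl (A : Type) (u w v : word A) :
  arises w v -> arises (wcat w u) (wcat v u).
Proof.
case/arisesE=> T [star [f [[canT1 canT2] fmono flab frange]]].
pose g (s : wdom (wcat v u)) : wdom (wcat w u) :=
  match s with inl s => inl (f s) | inr s => inr s end.
pose star' (s : wdom (wcat w u)) : wdom (wcat w u) :=
  match s with inl s => inl (star s) | inr s => inr s end.
have betE s t : @between _ (wcat w u) (inl s) (inl t) = inl @` between s t.
  apply/seteqP; split=> [[r sr | r /orP[] /andP[] //] | _ [r sr <-] //].
  by exists r.
apply: (@arises_embed A (wcat w u) (wcat v u) (inl @` T) star' g) => [||[]//|].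
- split=> _ [t Tt <-] /=.
    by have [? ->] := canT1 _ Tt; split=> //; exists (star t).
  have [subT imT labT] := canT2 _ Tt; rewrite betE; split=> //.
    by move=> _ [r rt <-]; exists r => //; apply: subT.
  by rewrite -[in RHS]imT 2!image_comp.
- by case=> s [] t //=.
- apply/seteqP; split=> [_ [[] s _ <-] /= [t Tt] // [] | [] r /= Tr].
  + by apply: contraPnot Tt => ->; have : range f (f s) by []; rewrite frange.
  + have : (~` T) r by move=> ?; apply: Tr; exists r.
    by rewrite -frange => -[s _ <-]; exists (inl s).
  + by exists (inr r).
Qed.

Lemma arises_catr (A : Type) (u w v : word A) :
  arises w v -> arises (wcat u w) (wcat u v).
Proof.
case/arisesE=> T [star [f [[canT1 canT2] fmono flab frange]]].
pose g (s : wdom (wcat u v)) : wdom (wcat u w) :=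
  match s with inr s => inr (f s) | inl s => inl s end.
pose star' (s : wdom (wcat u w)) : wdom (wcat u w) :=
  match s with inr s => inr (star s) | inl s => inl s end.
have betE s t : @between _ (wcat u w) (inr s) (inr t) = inr @` between s t.
  apply/seteqP; split=> [[r /orP[] /andP[] // | r sr] | _ [r sr <-] //].
  by exists r.
apply: (@arises_embed A (wcat u w) (wcat u v) (inr @` T) star' g) => [||[]//|].
- split=> _ [t Tt <-] /=.
    by have [? ->] := canT1 _ Tt; split=> //; exists (star t).
  have [subT imT labT] := canT2 _ Tt; rewrite betE; split=> //.
    by move=> _ [r rt <-]; exists r => //; apply: subT.
  by rewrite -[in RHS]imT 2!image_comp.
- by case=> s [] t //=.
- apply/seteqP; split=> [_ [[] s _ <-] /= [t Tt] // [] | [] r /= Tr].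
  + by apply: contraPnot Tt => ->; have : range f (f s) by []; rewrite frange.
  + by exists (inl r).
  + have : (~` T) r by move=> ?; apply: Tr; exists r.
    by rewrite -frange => -[s _ <-]; exists (inr s).
Qed.

Lemma arises_inv (A : Type) (w v : word A) :
  arises w v -> arises (winv w) (winv v).
Proof.
case/arisesE=> T [star [f [[canT1 canT2] fmono flab frange]]].
have betE s t : @between _ (winv w) s t = @between _ w s t.
  by apply/seteqP; split=> r /orP[] /andP[rs rt]; apply/orP;
    [right | left | right | left]; apply/andP.
apply: (@arises_embed _ (winv w) (winv v) T star f) => //.
- split=> // t Tt; have [subT imT labT] := canT2 _ Tt.
  by rewrite betE; split=> //=; rewrite labT.
- by move=> s t; rewrite /= /winv_le fmono.
- by move=> s /=; rewrite flab.
Qed.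

Lemma word_equiv_hom (A : Type) (F : word A -> word A) :
    (forall w v, arises w v -> arises (F w) (F v)) ->
  forall w v, word_equiv w v -> word_equiv (F w) (F v).
Proof.
move=> Farises w v; elim=> {w v}.
- by move=> w v wv; apply/rst_step/Farises.
- by move=> w; apply: rst_refl.
- by move=> w v _; apply: rst_sym.
- by move=> w v u _ Fwv _; apply: rst_trans.
Qed.

Lemma wcat_equiv (A : Type) (w w' v v' : word A) :
  word_equiv w w' -> word_equiv v v' -> word_equiv (wcat w v) (wcat w' v').
Proof.
move=> ww' vv'; apply: (@rst_trans _ _ _ (wcat w' v)).
  exact: (@word_equiv_hom A ((@wcat A)^~ v) (@arises_catl A v) _ _ ww').
exact: (@word_equiv_hom A (wcat w') (@arises_catr A w') _ _ vv').
Qed.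

Lemma winv_equiv (A : Type) (w v : word A) :
  word_equiv w v -> word_equiv (winv w) (winv v).
Proof. exact: (@word_equiv_hom A (@winv A) (@arises_inv A)). Qed.

Definition word_eqb (A : Type) : rel (word A) :=
  fun w v => `[< word_equiv w v >].

Lemma word_eqb_class (A : Type) : equiv_class_of (@word_eqb A).
Proof.
split.
- by move=> w; apply/asboolP/rst_refl.
- by move=> w v; apply/asboolP/asboolP; apply: rst_sym.
- by move=> v w u /asboolP wv /asboolP vu; apply/asboolP/rst_trans/vu.
Qed.

Canonical word_eqb_equiv (A : Type) := EquivRelPack (word_eqb_class A).

Definition BF (A : Type) := {eq_quot (@word_eqb A)}.

HB.instance Definition _ (A : Type) := Choice.on (BF A).
HB.instance Definition _ (A : Type) := EqQuotient.on (BF A).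

Section BigFreeGroup.
Context (A : Type).
Implicit Types (w v : word A) (g h : BF A).

Definition bf w : BF A := \pi_(BF A) w.

Definition bf_one : BF A := bf (wempty A).
Definition bf_mul g h : BF A := bf (wcat (repr g) (repr h)).
Definition bf_inv g : BF A := bf (winv (repr g)).

Lemma bfP w v : bf w = bf v <-> word_equiv w v.
Proof.
split=> [/eqP | /asboolP wv]; first by rewrite eqmodE => /asboolP.
by apply/eqP; rewrite eqmodE.
Qed.

Lemma bf_repr g : bf (repr g) = g.
Proof. exact: reprK. Qed.

Lemma repr_bf w : word_equiv (repr (bf w)) w.
Proof. by apply/bfP; rewrite bf_repr. Qed.

Lemma bf_mulE w v : bf_mul (bf w) (bf v) = bf (wcat w v).
Proof. by apply/bfP; apply: wcat_equiv; apply: repr_bf. Qed.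

Lemma bf_invE w : bf_inv (bf w) = bf (winv w).
Proof. by apply/bfP; apply: winv_equiv; apply: repr_bf. Qed.

Lemma bf_mulA : associative bf_mul.
Proof.
move=> g h k; rewrite -(bf_repr g) -(bf_repr h) -(bf_repr k) !bf_mulE.
apply/bfP; pose f s : wdom (wcat (repr g) (wcat (repr h) (repr k))) :=
  match s with
  | inl (inl s) => inl s | inl (inr s) => inr (inl s) | inr s => inr (inr s)
  end.
apply: (@iso_equiv _ _ (wcat (wcat _ _) _) f)
  => [[[]|] s [[]|] t | [[]|] s |] //.
by case=> [s|[]s]; [exists (inl (inl s))|exists (inl (inr s))|exists (inr s)].
Qed.

Lemma bf_mul1 : left_id bf_one bf_mul.
Proof.
move=> g; rewrite -(bf_repr g) bf_mulE; apply/bfP.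
by apply: (@iso_equiv _ (wcat _ _) _ inr) => // -[[]|s]; exists s.
Qed.

Lemma bf_mulr1 : right_id bf_one bf_mul.
Proof.
move=> g; rewrite -(bf_repr g) bf_mulE; apply/bfP.
by apply: (@iso_equiv _ (wcat _ _) _ inl) => // -[s|[]]; exists s.
Qed.

Lemma wmulV w : word_equiv (wcat w (winv w)) (wempty A).
Proof.
pose star (s : wdom (wcat w (winv w))) : wdom (wcat w (winv w)) :=
  match s with inl s => inr s | inr s => inl s end.
have starK : involutive star by case.
apply: rst_step.
apply: (@arises_embed A _ (wempty A) setT star (of_void _)) => [|[]|[]|].
- split=> // t _; split=> //.
  + have sub : star @` between t (star t) `<=` between t (star t).
      move=> _ [r + <-]; case: t r => t [] r /orP[] /andP[] //= rt tr;
      apply/orP; by [left; apply/andP | right; apply/andP].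
    apply/seteqP; split=> // r rt; exists (star r); last exact: starK.
    by apply: sub; exists r.
  + by case: t => t //=; rewrite linvK.
- by rewrite setCT; apply/seteqP; split=> // _ [[]].
Qed.

Lemma bf_mulV : right_inverse bf_one bf_inv bf_mul.
Proof.
by move=> g; rewrite -(bf_repr g) bf_invE bf_mulE; apply/bfP/wmulV.
Qed.

Lemma bf_mulVl : left_inverse bf_one bf_inv bf_mul.
Proof.
move=> g; rewrite -[RHS](bf_mulV (bf_inv g)); congr bf_mul.
rewrite -[RHS]bf_mul1 -(bf_mulV g) -bf_mulA bf_mulV.
by rewrite bf_mulr1.
Qed.

HB.instance Definition _ := isGroup.Build (BF A)
  bf_mulA bf_mul1 bf_mulr1 bf_mulVl bf_mulV.

Definition bf_letter (x : letter A) : BF A := bf (wletter x).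

(* The choice is harmless: each class contains exactly one reduced word up to
   [word_iso]. *)
Definition reduced_form g : word A :=
  xget (wempty A) [set w | reduced w /\ bf w = g].

Definition ends_in g (x : letter A) : Prop :=
  exists s : wdom (reduced_form g),
    (forall s', wle s' s) /\ reduced_form g s = x.

End BigFreeGroup.

Definition Zomega (A : omegaAlphabet) : Type := A -> int.

Section Zomega.
Context (A : omegaAlphabet).

HB.instance Definition _ := GRing.Zmodule.copy (Zomega A) (A -> int).

Definition Zomega_lt : rel (Zomega A) := fun s t =>
  `[< exists a : A, (s a < t a)%R /\ forall b : A, (b < a)%O -> s b = t b >].

Lemma Zomega_lt_irr : irreflexive Zomega_lt.
Proof. by move=> s; apply/asboolP => -[a []]; rewrite ltxx. Qed.

Lemma Zomega_lt_trans : transitive Zomega_lt.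
Proof.
move=> t s r /asboolP[a [sta eqa]] /asboolP[b [trb eqb]]; apply/asboolP.
case: (ltgtP a b) => [ab | ba | ab].
- exists a; split=> [|c ca]; first by rewrite -eqb.
  by rewrite eqa // eqb // (lt_trans ca).
- exists b; split=> [|c cb]; first by rewrite eqa.
  by rewrite eqa ?eqb // (lt_trans cb).
- exists a; split=> [|c ca]; first by rewrite (lt_trans sta) // ab.
  by rewrite eqa // eqb // -ab.
Qed.

HB.instance Definition _ := Order.Lt_isPOrder.Build ring_display (Zomega A)
  Zomega_lt_irr Zomega_lt_trans.

Lemma Zomega_ltP (s t : Zomega A) : reflect
  (exists a : A, (s a < t a)%R /\ forall b : A, (b < a)%O -> s b = t b)
  (s < t)%R.
Proof. exact: asboolP. Qed.

Lemma Zomega_le_total : total (<=%O : rel (Zomega A)).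
Proof.
move=> s t; have [->|/eqP st] := eqVneq s t; first by rewrite lexx.
have /alph_least[a /eqP sta min_a] : exists a, s a <> t a.
  apply: contrapT => /forallNP eq_st; apply: st.
  by apply/funext => a; apply: contrapT; apply: eq_st.
have eq_a b : (b < a)%O -> s b = t b by move=> /min_a/contrapT.
apply/orP; case: (ltgtP (s a) (t a)) sta => // st_a _; [left | right].
  by apply/ltW/Zomega_ltP; exists a.
by apply/ltW/Zomega_ltP; exists a; split=> // b /eq_a.
Qed.

HB.instance Definition _ := Order.POrder_isTotal.Build ring_display (Zomega A)
  Zomega_le_total.

End Zomega.

Section Tree.
Context (A : omegaAlphabet).
Local Open Scope ring_scope.
Implicit Types (g h : BF A) (n m : Zomega A).

Definition L g : Zomega A := fun a =>
  #|` fset_set ([set s | (reduced_form g s).1 = a]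
                 : set {classic wdom (reduced_form g)}) |%:Z.

(* The division by 2 is exact. *)
Definition c g h : Zomega A := fun a =>
  ((L g a + L h a - L (g^-1 * h)%g a) %/ 2)%Z.

Definition tree_pre : Type := {x : BF A * Zomega A | 0 <= x.2 <= L x.1}.

HB.instance Definition _ := SubChoice.on tree_pre.

Lemma L_ge0 g : 0 <= L g.
Proof.
rewrite leNgt; apply/negP => /Zomega_ltP[a []].
by rewrite ltNge => /negP La0 _; apply: La0; apply: le0z_nat.
Qed.

Lemma tree_pre0_subproof : 0 <= (0 : Zomega A) <= L 1%g.
Proof. by rewrite lexx L_ge0. Qed.

Definition tree_pre0 : tree_pre := Sub (1%g, 0) tree_pre0_subproof.

Definition tree_ident (x y : tree_pre) : Prop :=
  (val x).2 = (val y).2 /\ (val x).2 <= c (val x).1 (val y).1.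

Definition tree_eqb : rel tree_pre :=
  fun x y => `[< clos_refl_sym_trans tree_pre tree_ident x y >].

Lemma tree_eqb_class : equiv_class_of tree_eqb.
Proof.
split.
- by move=> x; apply/asboolP/rst_refl.
- by move=> x y; apply/asboolP/asboolP; apply: rst_sym.
- by move=> y x z /asboolP xy /asboolP yz; apply/asboolP/rst_trans/yz.
Qed.

Canonical tree_eqb_equiv := EquivRelPack tree_eqb_class.

Definition tree := {eq_quot tree_eqb}.

HB.instance Definition _ := Choice.on tree.
HB.instance Definition _ := EqQuotient.on tree.

(* The class <n, g>; outside the range [0 <= n <= L g] this is a junk value. *)
Definition pt n g : tree := \pi_tree (insubd tree_pre0 (g, n)).

Definition vertex g : tree := pt (L g) g.

(* The value does not depend on the representatives chosen by [repr]. *)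
Definition dist (x y : tree) : Zomega A :=
  let: (g, n) := val (repr x) in
  let: (h, m) := val (repr y) in
  n + m - Order.min n (Order.min m (c g h)) *+ 2.

Definition is_segment (x y : tree) (X : set tree) : Prop :=
  exists (a b : Zomega A) (f : Zomega A -> tree),
    [/\ a <= b,
        forall s t, a <= s <= b -> a <= t <= b ->
          dist (f s) (f t) = Order.max (s - t) (t - s),
        X = f @` [set s | a <= s <= b], f a = x & f b = y].

(* In a Zomega-tree exactly one [X] satisfies [is_segment x y X]. *)
Definition segment (x y : tree) : set tree :=
  [set z | exists2 X, is_segment x y X & X z].

(* Exactly one [y] satisfies the condition, so the default [x] is never used;
   every [x] is of the form <n, g>, so the condition is not vacuous. *)
Definition act h (x : tree) : tree :=
  xget x [set y | forall n g, 0 <= n <= L g -> x = pt n g ->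
    segment (vertex h) (vertex (h * g)%g) y /\ dist (vertex h) y = n].

(* The triple (g, x, t), where [x] is the signed letter a^p; [L] does not
   depend on the sign. *)
Definition is_triple g (x : letter A) (t : Zomega A) : Prop :=
  0 <= t < L (bf_letter (x.1, false)) /\ ~ ends_in g (linv x).

Definition triple g (x : letter A) (t : Zomega A) : tree :=
  pt (L g + t) (g * bf_letter x)%g.

End Tree.

(* Main.v *)
Require Import Defs.
From mathcomp Require Import all_boot all_order all_algebra finmap.
From mathcomp Require Import boolp classical_sets cardinality filter.
From mathcomp Require Import monoid zify.
From Stdlib Require Import Relation_Operators.

(** Deleting all letters of large rank turns a word into a finite word, whose
free reduction is invariant under cancellation; since each letter occurs
finitely often, pairings of the finite words can be glued along an ultrafilter.
Hence two equivalent reduced words [u], [v] admit a total noncrossing pairing of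
[u^-1 v]; by reducedness every pair joins the two factors, so that it is an
isomorphism. Likewise a maximal pairing of [u^-1 v] matches an initial segment
of [u] with one of [v], what remains is reduced, and [c(u, v)] is the length of
the matched segment. As the initial segments of a word form a chain, [c]
satisfies the isosceles inequality, from which the metric of the tree, the
segments between vertices and the action are computed. A point [<n, g>] is
represented by cutting the reduced word of [g] after the positions whose prefix
has length at most [n]: a discrepancy between [n] and the length of that initial
segment occurs at some letter [a], and only finitely many positions carry
letters up to [a]. *)

Set Implicit Arguments.
Unset Strict Implicit.
Unset Printing Implicit Defensive.

Import Order.TTheory GRing.Theory Num.Theory.

Local Open Scope classical_set_scope.
Local Open Scope quotient_scope.

(** * Free reduction of finite words *)

(** Nothing controls the intermediate words of the generated equivalence [word_equiv], and
    confluence of cancellations is never shown: the free reductions of the traces replace it as an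
    invariant. Pairings are relations rather than a set with an involution, because relations can be
    united along chains, restricted to a factor and pushed forward along an embedding. Words yield
    inequalities between lengths at every coordinate, while points of the tree are compared
    lexicographically. The coordinatewise form is kept as long as possible: it shows that no prefix
    lies strictly between [g] and [g x], although [Zomega] has infinitely many elements between 0
    and the length of a letter. Once ending in a letter is expressed as an equation between lengths,
    words disappear: uniqueness of triples and the action follow from the isosceles inequality and
    linear arithmetic. *)

Section FreeReduction.
Context (A : eqType).
Implicit Types (x y : letter A) (r s : seq (letter A)).

Definition push x r : seq (letter A) :=
  if r is y :: r' then if y == linv x then r' else x :: r else [:: x].

Definition free_reduced r := sorted (fun x y => y != linv x) r.

Lemma push_reduced x r : free_reduced r -> free_reduced (push x r).
Proof.
case: r => [|y r] //= red_r; case: ifPn => [_ | xy] /=; last by rewrite xy.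
exact: path_sorted red_r.
Qed.

(** Letters act on reduced lists by mutually inverse permutations (van der Waerden's trick), so
    reduction is compatible with cancelling a pair anywhere in a list. *)
Lemma pushK x r : free_reduced r -> push x (push (linv x) r) = r.
Proof.
case: r => [_ | y r red_r] /=; first by rewrite eqxx.
rewrite linvK; case: eqVneq => [<- | yx] /=; last by rewrite eqxx.
by case: r red_r => [|z r] //= /andP[/negPf->].
Qed.

Lemma foldr_push_reduced s r :
  free_reduced r -> free_reduced (foldr push r s).
Proof. by move=> red_r; elim: s => //= x s; apply: push_reduced. Qed.

Lemma foldr_push_id r : free_reduced r -> foldr push [::] r = r.
Proof.
elim: r => //= x r IHr red_r; rewrite IHr; last exact: path_sorted red_r.
by case: r red_r {IHr} => [|y r] //= /andP[/negPf->].
Qed.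

End FreeReduction.

Lemma not_sorted_split (T : Type) (e : rel T) (s : seq T) : ~~ sorted e s ->
  exists s1 x y s2, s = s1 ++ x :: y :: s2 /\ ~~ e x y.
Proof.
elim: s => [|x [|y s] IHs] //=; have [exy /= /IHs | exy _] := boolP (e x y).
  by move=> [s1 [x' [y' [s2 [-> ?]]]]]; exists (x :: s1), x', y', s2.
by exists [::], x, y, s.
Qed.

(** * Pairings *)

(* A cancellation given by the relation [s] in [T] and [t = s*]. *)
Record pairing (A : Type) (w : word A) (R : wdom w -> wdom w -> Prop) : Prop :=
  Pairing {
  pair_sym : forall s t, R s t -> R t s;
  pair_fun : forall s t t', R s t -> R s t' -> t = t';
  pair_lab : forall s t, R s t -> w t = linv (w s);
  pair_nest : forall s t r, R s t -> wle s r -> wle r t ->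
    exists r', [/\ R r r', wle s r' & wle r' t] }.

Definition unpaired (T : Type) (R : T -> T -> Prop) : set T :=
  [set s | ~ exists t, R s t].

Section Words.
Context (A : Type).
Implicit Types (w u v : word A).

Lemma wle_refl w (s : wdom w) : wle s s.
Proof. by have := @wle_total _ w s s; rewrite orbb. Qed.

Lemma wle_eq w (s t : wdom w) : wle s t -> wle t s -> s = t.
Proof. by move=> st ts; apply: (@wle_anti _ w); rewrite st ts. Qed.

Lemma wle_or w (s t : wdom w) : wle s t \/ wle t s.
Proof. exact/orP/wle_total. Qed.

Lemma linv_neq (x : letter A) : linv x <> x.
Proof. by case: x => a [] []. Qed.

Lemma pairing_neq w R : @pairing A w R -> forall s t, R s t -> s <> t.
Proof.
move=> pR s t Rst st; have := pair_lab pR Rst.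
by rewrite st => /esym/linv_neq.
Qed.

Lemma cancellation_pairing w T star : @cancellation A w T star ->
  pairing (fun s t => T s /\ t = star s).
Proof.
case=> canT1 canT2; split=> [s t [Ts ->] | s t t' [_ ->] [_ ->] | s t [Ts ->] |].
- by have [? ->] := canT1 _ Ts.
- by [].
- by have [_ _ ->] := canT2 _ Ts.
- move=> s t r [Ts ->] sr rs.
  have [subT imT lab] := canT2 _ Ts.
  have btw : between s (star s) r by rewrite /between/= sr rs.
  have : between s (star s) (star r) by rewrite -imT; exists r.
  move=> /orP[/andP[sr' rs'] | /andP[sr' rs']].
    by exists (star r); split=> //; split=> //; apply: subT.
  (* If the interval is traversed backwards, then [star s] precedes [s], so both coincide and a
     letter would be its own inverse. *)
  have ss' := wle_eq (wle_trans sr rs) (wle_trans sr' rs').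
  by rewrite -ss' in lab; have /esym/linv_neq := lab.
Qed.

Lemma pairing_cancellation w R : @pairing A w R ->
  exists star, cancellation [set s | exists t, R s t] star /\
    forall s t, R s t -> t = star s.
Proof.
move=> pR; pose star (s : wdom w) : wdom w :=
  @xget {classic wdom w} s [set t | R s t].
have starP s t : R s t -> R s (star s).
  by move=> Rst; rewrite /star; case: xgetP => [_ -> // | /(_ t)].
have starE s t : R s t -> t = star s.
  by move=> Rst; apply: (pair_fun pR Rst); apply: starP Rst.
have btwE s t : between s t = between t s :> set (wdom w).
  by apply/seteqP; split=> r; rewrite /between/= orbC.
exists star; split=> //; split=> t [t' Rtt'].
  rewrite -(starE _ _ Rtt'); have Rt't := pair_sym pR Rtt'.
  by split; [exists t | rewrite -(starE _ _ Rt't)].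
rewrite -(starE _ _ Rtt').
wlog tt' : t t' Rtt' / wle t t'.
  move=> Hwlog; have [/Hwlog|t't] := wle_or t t'; first exact.
  have Rt't := pair_sym pR Rtt'.
  have [sub im lab] := Hwlog _ _ Rt't t't; rewrite btwE; split=> //.
  by rewrite lab linvK.
have btw r : between t t' r -> exists2 r', R r r' & between t t' r'.
  move=> /orP[/andP[tr rt] | /andP[tr rt]].
    have [r' [Rr ? ?]] := pair_nest pR Rtt' tr rt.
    by exists r' => //; apply/orP; left; apply/andP.
  have tE := wle_eq tt' (wle_trans tr rt).
  by have := pairing_neq pR Rtt'.
split; last exact: pair_lab Rtt'.
- by move=> r /btw[r' Rr _]; exists r'.
- apply/seteqP; split=> [_ [r /btw[r' Rr br'] <-] | r /btw[r' Rr br']].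
    by rewrite -(starE _ _ Rr).
  by exists r' => //; rewrite -(starE _ _ (pair_sym pR Rr)).
Qed.

Lemma reducedP w :
  reduced w <-> forall R, @pairing A w R -> forall s t, ~ R s t.
Proof.
split=> [red_w R pR s t Rst | red_w T star canT].
  have [star [/red_w T0 _]] := pairing_cancellation pR.
  by have : [set s | exists t, R s t] s; [exists t | rewrite T0].
apply/seteqP; split=> // t Tt.
by have /(_ t (star t)) := red_w _ (cancellation_pairing canT); apply.
Qed.

Lemma pairing_arises w R : @pairing A w R ->
  arises w (wrestrict (w := w) (unpaired R)).
Proof.
move=> pR; have [star [canT _]] := pairing_cancellation pR.
exists [set s | exists t, R s t], star; split=> //.
by exists id; split=> //; exists id.
Qed.

Lemma arises_pairing w v : arises w v -> exists R (f : wdom v -> wdom w),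
  [/\ @pairing A w R, {mono f : s t / @wle A v s t >-> @wle A w s t},
      forall s, w (f s) = v s & range f = (unpaired R)].
Proof.
case/arisesE=> T [star [f [canT fmono flab frange]]].
exists (fun s t => T s /\ t = star s), f.
split=> //; first exact: cancellation_pairing canT.
rewrite frange; apply/seteqP; split=> s /= Ts.
  by case=> t [].
by move=> ?; apply: Ts; exists (star s).
Qed.

(** * Existence of reduced words *)

Definition wrel w (Q : set (wdom w * wdom w)) s t := Q (s, t).

(** Zorn's lemma applies because each clause of [pairing] starts from at most two pairs, which lie
    in a common member of a chain. *)
Lemma maximal_pairing w : exists R, @pairing A w R /\
  forall R', @pairing A w R' -> (forall s t, R s t -> R' s t) ->
    forall s t, R' s t -> R s t.
Proof.
have [|Q [pQ maxQ]] := @Zorn_bigcup _ [set Q | pairing (@wrel w Q)].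
  move=> F Fp Ftot; rewrite /wrel; split.
  - by move=> s t [X FX Xst]; exists X => //; apply: (pair_sym (Fp _ FX)).
  - move=> s t t' [X FX Xst] [Y FY Yst].
    have [XY | YX] := Ftot _ _ FX FY.
      by apply: (pair_fun (Fp _ FY) (XY _ Xst) Yst).
    by apply: (pair_fun (Fp _ FX) Xst (YX _ Yst)).
  - by move=> s t [X FX Xst]; apply: (pair_lab (Fp _ FX) Xst).
  - move=> s t r [X FX Xst] sr rt.
    have [r' [Xr ? ?]] := pair_nest (Fp _ FX) Xst sr rt.
    by exists r'; split=> //; exists X.
exists (wrel Q); split=> // R' pR' QR' s t R'st; apply: contrapT => nQst.
apply: (maxQ [set p | R' p.1 p.2]) => //; split=> [|sub].
  by case=> a b; apply: QR'.
by apply: nQst; apply: (sub (s, t)).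
Qed.

(** A pairing of the remaining word can be added to [R], so by maximality it is empty. Only nesting
    needs care, when an [R]-pair meets an interval of the new pairing. *)
Lemma maximal_pairing_reduced w R : @pairing A w R ->
  (forall R', @pairing A w R' -> (forall s t, R s t -> R' s t) ->
    forall s t, R' s t -> R s t) ->
  reduced (wrestrict (w := w) (unpaired R)).
Proof.
move=> pR maxR; apply/reducedP => Q pQ s0 t0 Qst0.
pose R' s t := R s t \/ exists s' t', [/\ Q s' t', sval s' = s & sval t' = t].
have noR (s' : {s | unpaired R s}) t : ~ R (sval s') t.
  by move=> Rst; have := svalP s'; apply; exists t.
suff pR' : pairing R'.
  apply: (noR s0 (sval t0)); apply: (maxR _ pR'); first by left.
  by right; exists s0, t0.
rewrite /R'; split.
- move=> s t [/(pair_sym pR)|[s' [t' [/(pair_sym pQ) ? ? ?]]]]; first by left.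
  by right; exists t', s'.
- move=> s t t1 [Rst|[s' [t' [Qst <- <-]]]] [Rst1 | [s1' [t1' [Qst1 E1 <-]]]].
  + exact: (pair_fun pR Rst).
  + by rewrite -E1 in Rst; case: (noR _ _ Rst).
  + by case: (noR _ _ Rst1).
  + by move/sval_inj: E1 => E1; rewrite E1 in Qst1; rewrite (pair_fun pQ Qst Qst1).
- move=> s t [/(pair_lab pR)//|[s' [t' [Qst <- <-]]]].
  exact: (pair_lab pQ Qst).
- move=> s t r [Rst sr rt | [s' [t' [Qst <- <-]]] sr rt].
    have [r' [Rr ? ?]] := pair_nest pR Rst sr rt.
    by exists r'; split=> //; left.
  have [[r' Rr] | nRr] := pselect (exists r', R r r'); last first.
    have [r' [Qr ? ?]] := pair_nest pQ Qst (r := exist _ r nRr) sr rt.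
    by exists (sval r'); split=> //; right; exists (exist _ r nRr), r'.
  (* If [r'] fell outside the interval, the end between [r'] and [r] would be paired by [R] through
     nesting, yet the ends are unpaired. *)
  exists r'; split=> //; first by left.
  + have [//|r's] := wle_or (sval s') r'.
    have [s1 [Rs _ _]] := pair_nest pR (pair_sym pR Rr) r's sr.
    by case: (noR _ _ Rs).
  + have [//|tr'] := wle_or r' (sval t').
    have [t1 [Rt _ _]] := pair_nest pR Rr rt tr'.
    by case: (noR _ _ Rt).
Qed.

Lemma exists_reduced w : exists v, arises w v /\ reduced v.
Proof.
have [R [pR maxR]] := maximal_pairing w.
exists (wrestrict (w := w) (unpaired R)).
by split; [apply: pairing_arises | apply: maximal_pairing_reduced].
Qed.

End Words.

(** * Finite traces *)

Lemma ultra_finite (I : Type) (T : eqType) (G : set_system I) (B : seq T)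
    (P : I -> T -> Prop) : UltraFilter G ->
  G [set i | exists2 t, t \in B & P i t] ->
  exists2 t, t \in B & G [set i | P i t].
Proof.
move=> GU; elim: B => [|b B IHB] GB.
  by have [i []] := filter_ex GB.
have [Gb | Gnb] := in_ultra_setVsetC [set i | P i b] GU.
  by exists b; rewrite ?mem_head.
have [|t tB Gt] := IHB; last by exists t; rewrite // in_cons tB orbT.
apply: filterS (filterI GB Gnb) => i /= [[t]]; rewrite in_cons.
by case/orP=> [/eqP-> // | tB Pt _]; exists t.
Qed.

(** The positions are viewed in [{classic wdom w}] because lists and finite sets of them need an
    [eqType] or [choiceType]. *)
Definition wlt (A : Type) (w : word A) : rel {classic wdom w} :=
  fun s t => ~~ wle t s.
Arguments wlt {A} w.

Section FiniteWords.
Context (A : eqType).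
Implicit Types (w u v : word A).

Lemma wlt_irr w : irreflexive (wlt w).
Proof. by move=> s; rewrite /wlt wle_refl. Qed.

Lemma wlt_le w s t : wlt w s t -> wle s t.
Proof. by move=> st; have [//|] := wle_or s t; move/negP: st. Qed.

Lemma wlt_trans w : transitive (wlt w).
Proof.
move=> t s r st tr; apply/negP => rs.
by move/negP: tr; apply; apply: wle_trans rs (wlt_le st).
Qed.

Lemma wle_lt w (s t : {classic wdom w}) : wle s t -> s != t -> wlt w s t.
Proof. by move=> st /eqP nst; apply/negP => /(wle_eq st). Qed.

Lemma sorted_split w (s1 s2 : seq {classic wdom w}) p :
    sorted (wlt w) (s1 ++ p :: s2) ->
  (forall s, s \in s1 -> wlt w s p) /\ (forall s, s \in s2 -> wlt w p s).
Proof.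
rewrite sorted_pairwise; last exact: wlt_trans.
rewrite pairwise_cat pairwise_cons => /and3P[/allrelP lt1 _ /andP[/allP lt2 _]].
by split=> s ss; [apply: lt1; rewrite ?mem_head | apply: lt2].
Qed.

(** Induction on [ps]. If the first position [p] is paired with [q], the block [sa] between them is
    closed under [R] by nesting, hence acts trivially, and then the letters at [p] and [q] cancel by
    [pushK]. The stack [r] is arbitrary because [sa] is reduced on top of what follows it. *)
Lemma trace_pairing w R (ps : seq {classic wdom w}) (r : seq (letter A)) :
    pairing R -> sorted (wlt w) ps ->
    (forall s t : {classic wdom w}, s \in ps -> R s t -> t \in ps) ->
    free_reduced r ->
  foldr (@push A) r (map w ps) =
  foldr (@push A) r (map w [seq s <- ps | `[< unpaired R s >]]).
Proof.
move=> pR; have [m] := ubnP (size ps); elim: m ps r => // m IHm [|p ps] r //=.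
rewrite ltnS => szps /[dup] sp /(order_path_min (@wlt_trans w)) minp cl red_r.
have sps : sorted (wlt w) ps by apply: path_sorted sp.
case: asboolP => [unp | /contrapT[q Rpq]].
  rewrite /= [in LHS](IHm ps) // => s t s_ps Rst.
  have := cl s t; rewrite !in_cons s_ps orbT => /(_ isT Rst).
  case/orP=> // /eqP tp; case: unp; exists s; apply: pair_sym => //.
  by rewrite -tp.
have q_ps : (q : {classic wdom w}) \in ps.
  have := cl p q; rewrite mem_head in_cons => /(_ isT Rpq).
  by case/orP=> // /eqP qp; case: (pairing_neq pR Rpq).
case/splitPr: q_ps szps sp minp cl sps => sa sb szps sp minp cl sps.
have lt_p s : s \in sa ++ q :: sb -> wlt w p s by move/(allP minp).
move: (sps); rewrite sorted_cat_cons // => /andP[ssa ssb].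
have lt_sa s : s \in sa -> wlt w s q.
  move: ssa; rewrite -cats1 sorted_pairwise; last exact: wlt_trans.
  rewrite pairwise_cat allrel1r => /andP[/allP + _]; exact.
have lt_sb s : s \in sb -> wlt w q s.
  by move: ssb => /(order_path_min (@wlt_trans w)) /allP; apply.
(* The partner lies between [p] and [q] by nesting, and it is neither of them because these are
   paired with each other. *)
have cl_sa s : s \in sa -> exists2 t : {classic wdom w}, R s t & t \in sa.
  move=> s_sa; have ps' : wlt w p s by apply: lt_p; rewrite mem_cat s_sa.
  have [t [Rst pt tq]] := pair_nest pR Rpq (wlt_le ps') (wlt_le (lt_sa _ s_sa)).
  exists t => //; have /= := cl s t.
  rewrite in_cons mem_cat s_sa orbT => /(_ isT Rst).
  rewrite in_cons mem_cat in_cons => /or4P[/eqP tp | // | /eqP te | t_sb].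
  - have qs := pair_fun pR Rpq (pair_sym pR (s := s) (t := p) _).
    rewrite -tp in qs; have := lt_sa _ s_sa; rewrite (qs Rst) wlt_irr //.
  - have sp' := pair_fun pR (pair_sym pR Rpq) (t' := s).
    rewrite -te in sp'; rewrite (sp' (pair_sym pR Rst)) wlt_irr // in ps'.
  - by have := lt_sb _ t_sb; rewrite /wlt tq.
have -> : [seq s <- sa ++ q :: sb | `[< unpaired R s >]] =
          [seq s <- sb | `[< unpaired R s >]].
  rewrite filter_cat /=; case: asboolP => [[]|_]; first by exists p; apply: pair_sym.
  rewrite (@eq_in_filter _ _ pred0 sa) ?filter_pred0 // => s s_sa.
  by apply/asboolP => -[]; have [t] := cl_sa _ s_sa; exists t.
have szE : (size sa + size sb < m)%N.
  by move: szps; rewrite size_cat /= addnS => /ltnW.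
have clsa s (t : {classic wdom w}) : s \in sa -> R s t -> t \in sa.
  by move=> s_sa Rst; have [t' Rst' ?] := cl_sa _ s_sa; rewrite (pair_fun pR Rst Rst').
have saE r' : free_reduced r' -> foldr (@push A) r' (map w sa) = r'.
  move=> red_r'; rewrite (IHm sa r') //.
  - rewrite (@eq_in_filter _ _ pred0 sa) ?filter_pred0 // => s s_sa.
    by apply/asboolP => -[]; have [t] := cl_sa _ s_sa; exists t.
  - by apply: leq_ltn_trans szE; rewrite leq_addr.
  - by have [] := cat_sorted2 sps.
rewrite map_cat foldr_cat /= saE; last first.
  by apply/push_reduced/foldr_push_reduced.
rewrite (pair_lab pR Rpq) pushK; last exact: foldr_push_reduced.
apply: IHm => //.
- by apply: leq_ltn_trans szE; rewrite leq_addl.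
- exact: path_sorted ssb.
- move=> s t s_sb Rst; have := cl s t.
  rewrite in_cons mem_cat in_cons s_sb !orbT => /(_ isT Rst).
  rewrite in_cons mem_cat in_cons => /or4P[/eqP tp | t_sa | /eqP te | //].
  + have := pair_fun pR Rpq (t' := s); rewrite -tp => /(_ (pair_sym pR Rst)) qs.
    by have := lt_sb _ s_sb; rewrite qs wlt_irr.
  + have s_sa := clsa _ _ t_sa (pair_sym pR Rst).
    by have := wlt_trans (lt_sa _ s_sa) (lt_sb _ s_sb); rewrite wlt_irr.
  + have := pair_fun pR (pair_sym pR Rpq) (t' := s).
    rewrite -te => /(_ (pair_sym pR Rst)) p_s.
    by have := lt_p s; rewrite mem_cat in_cons s_sb !orbT -p_s wlt_irr => /(_ isT).
Qed.

(** A nonempty list with empty reduction contains two adjacent inverse letters; they are paired and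
    removed. The result is not a [pairing] of [w]: positions outside [ps] may lie between paired
    ones, so nesting is asserted only for paired [r]. *)
Lemma finite_pairing w (ps : seq {classic wdom w}) :
    sorted (wlt w) ps -> foldr (@push A) [::] (map w ps) = [::] ->
  exists R : {classic wdom w} -> {classic wdom w} -> Prop,
    [/\ forall s t, R s t -> s \in ps,
        forall s t, R s t -> R t s,
        forall s t t', R s t -> R s t' -> t = t',
        forall s t, R s t -> w t = linv (w s) &
        (forall s, s \in ps -> exists t, R s t) /\
        forall s t r r', R s t -> R r r' ->
          wle s r -> wle r t -> wle s r' /\ wle r' t].
Proof.
have [m] := ubnP (size ps); elim: m ps => // m IHm ps.
rewrite ltnS => szps sps red0.
have [ps0 | ps_n0] := eqVneq ps [::].
  by exists (fun _ _ => False); split=> //; split=> //; rewrite ps0.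
have : ~~ sorted (fun x y => y != linv x) (map w ps).
  apply/negP => /foldr_push_id; rewrite red0 => /esym/(congr1 size).
  by rewrite size_map => /size0nil ps0; rewrite ps0 in ps_n0.
rewrite sorted_map => /(@not_sorted_split {classic wdom w})[s1 [p [q [s2 [psE /= pq]]]]].
have {}pq : w q = linv (w p) by apply/eqP; rewrite -[_ == _]negbK.
subst ps; have sz2 : (size (s1 ++ s2) < m)%N.
  by move: szps; rewrite !size_cat /= !addnS; apply: ltnW.
have [lt_p gt_p] := sorted_split sps.
have lt_pq : wlt w p q by apply: gt_p; rewrite mem_head.
have [|_ gt_q] := @sorted_split w (rcons s1 p) s2 q; first by rewrite cat_rcons.
have sps12 : sorted (wlt w) (s1 ++ s2).
  apply: (subseq_sorted (@wlt_trans w)) sps.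
  by rewrite cat_subseq // (subseq_trans _ (subseq_cons _ _)) ?subseq_cons.
have [|R [Rmem Rsym Rfun Rlab [Rtot Rnest]]] := IHm _ sz2 sps12.
  rewrite map_cat foldr_cat; move: red0; rewrite map_cat foldr_cat /=.
  rewrite pq pushK //; exact: foldr_push_reduced.
have psE s : (s \in s1 ++ p :: q :: s2) = [|| s == p, s == q | s \in s1 ++ s2].
  by rewrite !mem_cat !in_cons; case: (s == p) (s == q) (s \in s1) => [] [] [].
have p12 : p \notin s1 ++ s2.
  rewrite mem_cat; apply/norP; split; apply/negP.
    by move/lt_p; rewrite wlt_irr.
  by move=> ps2; have := gt_p p; rewrite in_cons ps2 orbT wlt_irr => /(_ isT).
have q12 : q \notin s1 ++ s2.
  rewrite mem_cat; apply/norP; split; apply/negP.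
    by move/lt_p/(wlt_trans lt_pq); rewrite wlt_irr.
  by move/gt_q; rewrite wlt_irr.
have Rn s t : R s t -> [/\ s <> p, s <> q, t <> p & t <> q].
  move=> Rst; have Rs := Rmem _ _ Rst; have Rt := Rmem _ _ (Rsym _ _ Rst).
  by split=> E; move: Rs Rt; rewrite E ?(negPf p12) ?(negPf q12).
(* As [p] and [q] are adjacent in the list, every other listed position compares in the same way
   with both. *)
have pq_adj s : s \in s1 ++ s2 -> (wle s p = wle s q) * (wle p s = wle q s).
  rewrite mem_cat => /orP[/lt_p sp | /gt_q qs]; split.
  - by rewrite !wlt_le //; apply: wlt_trans lt_pq.
  - have := wlt_trans sp lt_pq.
    by move: sp; rewrite /wlt => /negPf-> /negPf->.
  - have := wlt_trans lt_pq qs.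
    by move: qs; rewrite /wlt => /negPf-> /negPf->.
  - by rewrite !wlt_le //; apply: wlt_trans qs.
exists (fun s t => [\/ R s t, s = p /\ t = q | s = q /\ t = p]); split.
- by move=> s t; rewrite psE => -[/Rmem->|[-> _]|[-> _]]; rewrite ?eqxx ?orbT.
- by move=> s t [/Rsym|[-> ->]|[-> ->]]; [constructor 1|constructor 3|constructor 2].
- move=> s t t' [Rst|[? ?]|[? ?]] [Rst'|[? ?]|[? ?]]; subst;
    rewrite ?wlt_irr // in lt_pq *;
    by [apply: Rfun Rst Rst' | have [] := Rn _ _ Rst | have [] := Rn _ _ Rst'].
- by move=> s t [/Rlab|[-> ->]|[-> ->]] //; rewrite pq linvK.
split=> [s | s t r r'].
  rewrite psE => /or3P[/eqP-> | /eqP-> | /Rtot[t Rst]].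
  - by exists q; constructor 2.
  - by exists p; constructor 3.
  - by exists t; constructor 1.
case=> [Rst|[-> ->]|[-> ->]]; last first.
  move=> _ qr rp; have : wle q p by apply: wle_trans qr rp.
  by move/negP: lt_pq.
- case=> [Rr pr rq|[-> ->] _ _|[-> ->] _ _].
  + have qr : wle q r by rewrite -(pq_adj _ (Rmem _ _ Rr)).
    by have [_ /(_ (wle_eq rq qr))] := Rn _ _ Rr.
  + by rewrite wlt_le ?wle_refl.
  + by rewrite (wlt_le lt_pq) wle_refl.
- have Ms := Rmem _ _ Rst; have Mt := Rmem _ _ (Rsym _ _ Rst).
  case=> [Rr|[-> ->]|[-> ->]]; first exact: Rnest Rst Rr.
  + by rewrite !(pq_adj _ Ms, pq_adj _ Mt).
  + by rewrite !(pq_adj _ Ms, pq_adj _ Mt).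
Qed.

Section Traces.
Variables (rank : A -> nat) (rank_inj : injective rank).

Definition small w n : set (wdom w) := [set s | (rank (w s).1 < n)%N].
Arguments small : clear implicits.

Lemma finite_labels w (B : set (letter A)) :
  finite_set B -> finite_set (w @^-1` B).
Proof.
move=> finB; apply: sub_finite_set (_ : _ `<=` \bigcup_(x in B) (w @^-1` [set x])) _.
  by move=> s /= Bs; exists (w s).
by apply: bigcup_finite => // x _; apply: wfin.
Qed.

Lemma finite_small w n : finite_set (small w n).
Proof.
apply: (@finite_labels w [set x : letter A | (rank x.1 < n)%N]).
apply: (@finite_preimage _ _ [set p : nat * bool | (p.1 < n)%N]
          (fun x : letter A => (rank x.1, x.2))).
  by move=> [a p] [b q] _ _ /= [/rank_inj-> ->].
apply: sub_finite_set (_ : _ `<=` `I_n `*` [set: bool]) _; first by [].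
by apply: finite_setX; [apply: finite_II | apply: finite_finset].
Qed.

Definition posn w n : seq {classic wdom w} :=
  sort (@wle A w) (fset_set (small w n : set {classic wdom w})).

Lemma mem_posn w n (s : {classic wdom w}) : s \in posn w n <-> small w n s.
Proof.
rewrite mem_sort in_fset_set; last exact: finite_small.
by rewrite in_setE.
Qed.

Lemma posn_sorted w n : sorted (wlt w) (posn w n).
Proof.
have := sort_sorted (@wle_total _ w) (fset_set (small w n : set {classic wdom w})).
have : uniq (posn w n) by rewrite sort_uniq fset_uniq.
rewrite -/(posn w n); elim: (posn w n) => [|s [|t ps] IHps] //.
rewrite cons_uniq in_cons negb_or => /andP[/andP[st _] ups] /= /andP[le_st sps].
by apply/andP; split; [apply: wle_lt | apply: IHps].
Qed.

Definition trace w n := map w (posn w n).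

(** Paired positions carry letters of equal rank, so the positions of small rank are closed under
    the pairing and [trace_pairing] applies to them. *)
Lemma arises_trace w v n : arises w v ->
  foldr (@push A) [::] (trace w n) = foldr (@push A) [::] (trace v n).
Proof.
case/arises_pairing=> R [f [pR fmono flab frange]].
rewrite /trace (trace_pairing pR (posn_sorted w n)) //; last first.
  by move=> s t /mem_posn + /(pair_lab pR) wt; rewrite mem_posn /small /= wt.
congr foldr; rewrite (eq_map (g := w \o f)); last by move=> s /=; rewrite flab.
rewrite map_comp; congr map.
apply: (irr_sorted_eq (@wlt_trans w) (@wlt_irr w)).
- by apply: sorted_filter; [apply: wlt_trans | apply: posn_sorted].
- rewrite sorted_map (@eq_sorted _ _ (wlt v)); first exact: posn_sorted.
  by move=> s t; rewrite /wlt /= fmono.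
- move=> s; rewrite mem_filter; apply/idP/idP.
    move=> /andP[/asboolP us /mem_posn ss].
    rewrite -frange in us; case: us => r _ frs.
    apply/(@mapP {classic wdom v} {classic wdom w}); exists r => //.
    by apply/mem_posn; rewrite /small /= -flab frs.
  move=> /(@mapP {classic wdom v} {classic wdom w})[r /mem_posn sr ->].
  apply/andP; split; first by apply/asboolP; rewrite -frange; exists r.
  by apply/mem_posn; rewrite /small /= flab.
Qed.

Lemma equiv_trace w v n : word_equiv w v ->
  foldr (@push A) [::] (trace w n) = foldr (@push A) [::] (trace v n).
Proof.
elim=> {w v} [w v /arises_trace-> | w | w v _ -> | w v u _ -> _ ->] //.
Qed.

(* The pairings of the finite traces need not be compatible; an ultrafilter
   makes the choice, each position having only finitely many candidates. *)
Lemma trivial_traces_pairing w :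
    (forall n, foldr (@push A) [::] (trace w n) = [::]) ->
  exists R, @pairing A w R /\ forall s, exists t, R s t.
Proof.
move=> tr0; have /choice[R RP] n := finite_pairing (posn_sorted w n) (tr0 n).
(* Extending the filter of cofinal ranges ensures that every position belongs to the trace for
   [G]-almost all [n]. *)
have [G [GU subG]] := ultraFilterLemma eventually_filter.
pose Q (s t : {classic wdom w}) := G [set n | R n s t].
have evG (s : {classic wdom w}) : G [set n | s \in posn w n].
  apply: subG; exists (rank (w s).1).+1 => // n /= sn.
  exact/mem_posn.
(* A partner of [s] has the rank of [s], so whatever [n] is it lies in the fixed finite list
   [posn w m]. The property [P] is chosen together with the partner; this makes nesting pass to the
   limit. *)
have part (s : {classic wdom w}) (P : nat -> {classic wdom w} -> Prop) :
    G [set n | exists2 t, R n s t & P n t] ->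
    exists2 t, Q s t & G [set n | R n s t /\ P n t].
  move=> GP; pose m := (rank (w s).1).+1.
  have [|t tm Gt] := @ultra_finite _ {classic wdom w} G (posn w m)
      (fun n t => R n s t /\ P n t) GU.
    apply: filterS GP => n /= [t Rst Pt]; exists t => //.
    have [_ _ _ Rlab _] := RP n.
    by apply/mem_posn; rewrite /small /= (Rlab _ _ Rst).
  by exists t => //; apply: filterS Gt => n [].
exists Q; split; last first.
  move=> s; have [|t Qst _] := part s (fun _ _ => True); last by exists t.
  apply: filterS (evG s) => n /= sn.
  by have [_ _ _ _ [Rtot _]] := RP n; have [t] := Rtot _ sn; exists t.
split.
- by move=> s t; apply: filterS => n /=; have [_ Rsym _ _ _] := RP n; apply: Rsym.
- move=> s t t' Qst Qst'; have [n [/= Rst Rst']] := filter_ex (filterI Qst Qst').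
  by have [_ _ Rfun _ _] := RP n; apply: Rfun Rst Rst'.
- move=> s t Qst; have [n /= Rst] := filter_ex Qst.
  by have [_ _ _ Rlab _] := RP n; apply: Rlab.
- move=> s t r Qst sr rt.
  have [|r' Qr Gr] := part r (fun _ r' => wle s r' /\ wle r' t).
    apply: filterS (filterI Qst (evG r)) => n [/= Rst rn].
    have [_ _ _ _ [Rtot Rnest]] := RP n; have [r' Rr] := Rtot _ rn.
    by exists r' => //; apply: Rnest Rst Rr sr rt.
  by exists r'; have [n [_ []]] := filter_ex Gr.
Qed.

Lemma equiv_pairing u v : word_equiv u v ->
  exists R, @pairing A (wcat (winv u) v) R /\ forall s, exists t, R s t.
Proof.
move=> uv; apply: trivial_traces_pairing => n.
have /(equiv_trace n)-> : word_equiv (wcat (winv u) v) (wempty A).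
  apply: (@rst_trans _ _ _ (wcat (winv u) u)).
    by apply: wcat_equiv; [apply: rst_refl | apply: rst_sym].
  apply/bfP; rewrite -bf_mulE -bf_invE; exact: bf_mulVl.
rewrite /trace; suff -> : posn (wempty A) n = [::] by [].
by case: (posn _ _) => // -[].
Qed.

End Traces.

End FiniteWords.

(** * Uniqueness of reduced words *)

Section Embeddings.
Context (A : Type).
Implicit Types (w u v : word A).

Record embedding v w (f : wdom v -> wdom w) : Prop := Embedding {
  emb_le : {mono f : s t / @wle A v s t >-> @wle A w s t};
  emb_lab : forall s, w (f s) = v s }.

(** The image is an interval: this is what lets pairings be restricted to a factor, or extended from
    it, without breaking nesting. *)
Definition convex_map (S T : Type) (le : rel T) (f : S -> T) : Prop :=
  forall s t r, le (f s) r -> le r (f t) -> exists r', f r' = r.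

Lemma emb_inj v w (f : wdom v -> wdom w) : embedding f -> injective f.
Proof.
move=> ef s t fst; apply: wle_eq; rewrite -(emb_le ef) fst; exact: wle_refl.
Qed.

Lemma inl_embedding u v : embedding (inl : wdom u -> wdom (wcat u v)).
Proof. by []. Qed.

Lemma inr_embedding u v : embedding (inr : wdom v -> wdom (wcat u v)).
Proof. by []. Qed.

Lemma inl_convex u v : convex_map (@wle A (wcat u v)) inl.
Proof. by move=> s t [r|r] // _ _; exists r. Qed.

Lemma inr_convex u v : convex_map (@wle A (wcat u v)) inr.
Proof. by move=> s t [r|r] // _ _; exists r. Qed.

Lemma sval_embedding w (U : set (wdom w)) :
  embedding (sval : wdom (wrestrict U) -> wdom w).
Proof. by []. Qed.

Lemma pairing_pull v w (f : wdom v -> wdom w) R :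
    embedding f -> convex_map (@wle A w) f -> pairing R ->
  pairing (fun s t => R (f s) (f t)).
Proof.
move=> ef cf pR; split.
- by move=> s t; apply: (pair_sym pR).
- by move=> s t t' Rst /(pair_fun pR Rst) /(emb_inj ef).
- by move=> s t /(pair_lab pR); rewrite !(emb_lab ef).
- move=> s t r Rst; rewrite -!(emb_le ef) => sr rt.
  have [r' [Rr sr' rt']] := pair_nest pR Rst sr rt.
  have [r1 r1E] := cf _ _ _ sr' rt'; exists r1.
  by rewrite -!(emb_le ef) r1E.
Qed.

Lemma reduced_convex v w (f : wdom v -> wdom w) :
  embedding f -> convex_map (@wle A w) f -> reduced w -> reduced v.
Proof.
move=> ef cf /reducedP red_w; apply/reducedP => R pR s0 t0 Rst0.
apply: (red_w (fun s t => exists s' t', [/\ R s' t', f s' = s & f t' = t]) _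
              (f s0) (f t0)); last by exists s0, t0.
split.
- by move=> s t [s' [t' [Rst <- <-]]]; exists t', s'; split=> //; apply: (pair_sym pR).
- move=> s t t1 [s' [t' [Rst <- <-]]] [s1 [t1' [Rst1 /(emb_inj ef) E <-]]].
  by rewrite E in Rst1; rewrite (pair_fun pR Rst Rst1).
- by move=> s t [s' [t' [Rst <- <-]]]; rewrite !(emb_lab ef) (pair_lab pR Rst).
- move=> s t r [s' [t' [Rst <- <-]]] sr rt.
  have [r' rE] := cf _ _ _ sr rt; move: sr rt; rewrite -rE !(emb_le ef) => sr rt.
  have [r1 [Rr ? ?]] := pair_nest pR Rst sr rt.
  by exists (f r1); rewrite !(emb_le ef); split=> //; exists r', r1.
Qed.

Lemma pairing_inv u R : @pairing A (winv u) R -> @pairing A u R.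
Proof.
move=> pR; split=> [|||s t r Rst sr rt].
- exact: pair_sym pR.
- exact: pair_fun pR.
- by move=> s t /(pair_lab pR) /= /(can_inj (@linvK A)).
- have [r' [? ? ?]] := pair_nest pR (pair_sym pR Rst) (r := r) rt sr.
  by exists r'.
Qed.

Lemma reduced_inv u : reduced u -> reduced (winv u).
Proof.
by move=> /reducedP red_u; apply/reducedP => R /pairing_inv/red_u.
Qed.

Lemma reduced_cat_across u v R : reduced u -> reduced v ->
    @pairing A (wcat u v) R ->
  (forall s t, ~ R (inl s) (inl t)) /\ (forall s t, ~ R (inr s) (inr t)).
Proof.
move=> /reducedP red_u /reducedP red_v pR; split.
- exact: red_u (pairing_pull (inl_embedding u v) (@inl_convex u v) pR).
- exact: red_v (pairing_pull (inr_embedding u v) (@inr_convex u v) pR).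
Qed.

Definition initial w (I : set (wdom w)) : Prop :=
  forall s t, I t -> wle s t -> I s.

(* An isomorphism between an initial segment of [u] and one of [v]. *)
Record matching u v (M : wdom u -> wdom v -> Prop) : Prop := Matching {
  match_fun : forall s t t', M s t -> M s t' -> t = t';
  match_inj : forall s s' t, M s t -> M s' t -> s = s';
  match_lab : forall s t, M s t -> v t = u s;
  match_left : forall s t s', M s t -> wle s' s ->
    exists2 t', M s' t' & wle t' t;
  match_right : forall s t t', M s t -> wle t' t ->
    exists2 s', M s' t' & wle s' s }.

(** All pairs straddle the junction of [u^-1] and [v]. Since [u^-1] reverses [u], the interval
    spanned by a pair consists of the initial segments of [u] and [v] ending at its two ends, and
    the two inversions of the label cancel. *)
Lemma pairing_matching u v R : reduced u -> reduced v ->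
    @pairing A (wcat (winv u) v) R ->
  @matching u v (fun s t => R (inl s) (inr t)).
Proof.
move=> red_u red_v pR.
have [noL noR] := reduced_cat_across (reduced_inv red_u) red_v pR.
split.
- by move=> s t t' Rst /(pair_fun pR Rst)[].
- by move=> s s' t /(pair_sym pR) Rts /(pair_sym pR) /(pair_fun pR Rts)[].
- by move=> s t /(pair_lab pR) /= ->; rewrite linvK.
- move=> s t s' Rst s's.
  have [[r|r] [Rr _ rt]] := pair_nest pR Rst (r := inl s') s's isT.
    by case: (noL _ _ Rr).
  by exists r.
- move=> s t t' Rst t't.
  have [[r|r] [Rr sr _]] := pair_nest pR Rst (r := inr t') isT t't.
    by exists r => //; apply: (pair_sym pR).
  by case: (noR _ _ Rr).
Qed.

Section Matching.
Variables (u v : word A) (M : wdom u -> wdom v -> Prop).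
Hypothesis matchM : matching M.

Definition match_dom : set (wdom u) := [set s | exists t, M s t].
Definition match_cod : set (wdom v) := [set t | exists s, M s t].

Lemma match_dom_initial : initial match_dom.
Proof.
move=> s' s [t Mst] /(match_left matchM Mst)[t' Ms't' _]; by exists t'.
Qed.

Lemma match_cod_initial : initial match_cod.
Proof.
move=> t' t [s Mst] /(match_right matchM Mst)[s' Ms't' _]; by exists s'.
Qed.

Lemma match_mono s t s' t' : M s t -> M s' t' -> wle s s' = wle t t'.
Proof.
move=> Mst Ms't'; apply/idP/idP.
  move=> /(match_left matchM Ms't')[t1 Mst1].
  by rewrite (match_fun matchM Mst Mst1).
move=> /(match_right matchM Ms't')[s1 Ms1t].
by rewrite (match_inj matchM Mst Ms1t).
Qed.

Lemma match_iso : word_iso (wrestrict match_dom) (wrestrict match_cod).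
Proof.
have /choice[f fM] (s : wdom (wrestrict match_dom)) :
    exists t : wdom (wrestrict match_cod), M (sval s) (sval t).
  case: (svalP s) => t Mst; have Jt : match_cod t by exists (sval s).
  by exists (exist _ t Jt).
have /choice[g gM] (t : wdom (wrestrict match_cod)) :
    exists s : wdom (wrestrict match_dom), M (sval s) (sval t).
  case: (svalP t) => s Mst; have Is : match_dom s by exists (sval t).
  by exists (exist _ s Is).
exists f; split.
- exists g => [s | t]; apply: sval_inj.
    exact: (match_inj matchM (gM _) (fM s)).
  exact: (match_fun matchM (fM _) (gM t)).
- by move=> s t /=; rewrite /wrestrict_le (match_mono (fM s) (fM t)).
- by move=> s /=; rewrite (match_lab matchM (fM s)).
Qed.

End Matching.

Lemma total_word_iso w : word_iso (wrestrict (w := w) setT) w.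
Proof.
exists sval; split=> //; exists (fun s => exist setT s I) => [s|//].
exact: sval_inj.
Qed.

Lemma word_iso_sym u v : word_iso u v -> word_iso v u.
Proof.
move=> [phi [[psi phiK psiK] mono lab]]; exists psi; split.
- by exists phi.
- by move=> s t; rewrite -mono !psiK.
- by move=> s; rewrite -lab psiK.
Qed.

Lemma word_iso_trans u v w : word_iso u v -> word_iso v w -> word_iso u w.
Proof.
move=> [f [bf_ fm fl]] [g [bg gm gl]]; exists (g \o f); split.
- exact: bij_comp.
- by move=> s t /=; rewrite gm fm.
- by move=> s /=; rewrite gl fl.
Qed.

Lemma word_iso_embedding u v : word_iso u v ->
  exists2 f : wdom u -> wdom v, embedding f & forall t, exists s, f s = t.
Proof.
move=> [f [[g fK gK] fm fl]]; exists f; first by split.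
by move=> t; exists (g t).
Qed.

Lemma word_iso_equiv u v : word_iso u v -> word_equiv u v.
Proof.
move=> /word_iso_embedding[f ef fs]; apply/rst_sym.
exact: (iso_equiv (emb_le ef) (emb_lab ef)).
Qed.

End Embeddings.

Lemma omega_rank (A : omegaAlphabet) : exists rank : A -> nat, injective rank.
Proof.
by have [e [[f eK fK] _]] := alph_omega A; exists f; apply: can_inj fK.
Qed.

Lemma reduced_unique (A : omegaAlphabet) (u v : word A) :
  reduced u -> reduced v -> word_equiv u v -> word_iso u v.
Proof.
move=> red_u red_v uv; have [rank rank_inj] := omega_rank A.
have [R [pR totR]] := equiv_pairing rank_inj uv.
have [noL noR] := reduced_cat_across (reduced_inv red_u) red_v pR.
have mR := pairing_matching red_u red_v pR.
have := match_iso mR.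
have -> : match_dom (fun (s : wdom u) (t : wdom v) => R (inl s) (inr t)) = setT.
  apply/seteqP; split=> // s _; have [[t|t] Rst] := totR (inl s); last by exists t.
  by case: (noL _ _ Rst).
have -> : match_cod (fun (s : wdom u) (t : wdom v) => R (inl s) (inr t)) = setT.
  apply/seteqP; split=> // t _; have [[s|s] Rts] := totR (inr t).
    by exists s; apply: (pair_sym pR).
  by case: (noR _ _ Rts).
move=> iso; apply: word_iso_trans (total_word_iso v).
by apply: word_iso_trans iso; apply/word_iso_sym/total_word_iso.
Qed.

(** * Counting letters *)

Section Occurrences.
Context (A : Type).
Implicit Types (w u v : word A) (a : A).

Definition occ w (U : set (wdom w)) a : nat :=
  #|` fset_set ([set s | U s /\ (w s).1 = a] : set {classic wdom w})|.

Lemma finite_occ w (U : set (wdom w)) a :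
  finite_set [set s | U s /\ (w s).1 = a].
Proof.
apply: (@sub_finite_set _ _ (w @^-1` [set (a, false)] `|` w @^-1` [set (a, true)])).
  by move=> s /= [_]; case: (w s) => b [] /= ->; [right | left].
by rewrite finite_setU; split; apply: wfin.
Qed.

Lemma occU w (U V : set (wdom w)) a : (forall s, U s -> ~ V s) ->
  occ (U `|` V) a = (occ U a + occ V a)%N.
Proof.
move=> UV; rewrite /occ.
have -> : [set s | (U `|` V) s /\ (w s).1 = a] =
   [set s | U s /\ (w s).1 = a] `|` [set s | V s /\ (w s).1 = a].
  apply/seteqP; split=> [s [[?|?] ?]|s [[? ?]|[? ?]]].
  - by left.
  - by right.
  - by split=> //; left.
  - by split=> //; right.
rewrite (@fset_setU {classic wdom w}) ?cardfsU; [| exact: finite_occ..].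
rewrite -(@fset_setI {classic wdom w}); [| exact: finite_occ..].
rewrite (_ : _ `&` _ = set0) ?fset_set0 ?cardfs0 ?subn0 //.
by apply/seteqP; split=> // s [[/UV Vs _] []].
Qed.

Lemma occC w (U : set (wdom w)) a :
  occ (w := w) setT a = (occ U a + occ (~` U) a)%N.
Proof. by rewrite -occU ?setUv // => s Us /(_ Us). Qed.

Lemma occD w (U V : set (wdom w)) a : U `<=` V ->
  occ V a = (occ U a + occ (V `\` U) a)%N.
Proof.
move=> UV; rewrite -occU => [|s Us []//]; congr occ.
by rewrite setDUK.
Qed.

Lemma occ_image v w (f : wdom v -> wdom w) (U : set (wdom v)) a :
  embedding f -> occ (f @` U) a = occ U a.
Proof.
move=> ef; rewrite /occ.
have -> : [set s | (f @` U) s /\ (w s).1 = a] = f @` [set s | U s /\ (v s).1 = a].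
  apply/seteqP; split=> [_ [[s Us <-]]|_ [s [Us sa] <-]].
    by rewrite (emb_lab ef); exists s.
  by rewrite /= (emb_lab ef); split=> //; exists s.
rewrite (@fset_set_image {classic wdom v} {classic wdom w}); last exact: finite_occ.
by rewrite card_imfset //; apply: emb_inj ef.
Qed.

Lemma occ_restrict w (U : set (wdom w)) a :
  occ (w := wrestrict U) setT a = occ U a.
Proof.
rewrite -(occ_image setT a (sval_embedding U)); congr occ.
apply/seteqP; split=> [_ [s _ <-]|s Us]; first exact: svalP.
by exists (exist _ s Us).
Qed.

Lemma occ_iso u v a : word_iso u v -> occ (w := u) setT a = occ (w := v) setT a.
Proof.
move=> /word_iso_embedding[f ef fs]; rewrite -(occ_image setT a ef); congr occ.
by apply/seteqP; split=> // t _; have [s <-] := fs t; exists s.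
Qed.

Lemma occ_cat u v (U : set (wdom u)) (V : set (wdom v)) a :
  occ (w := wcat u v) (inl @` U `|` inr @` V) a = (occ U a + occ V a)%N.
Proof.
rewrite occU; last by move=> _ [s _ <-] [].
by rewrite (occ_image _ _ (inl_embedding u v)) (occ_image _ _ (inr_embedding u v)).
Qed.

Lemma occ_catT u v a :
  occ (w := wcat u v) setT a = (occ (w := u) setT a + occ (w := v) setT a)%N.
Proof.
rewrite -occ_cat; congr occ; apply/seteqP; split=> // -[s|s] _.
  by left; exists s.
by right; exists s.
Qed.

Lemma occ_inv u (U : set (wdom u)) a : occ (w := winv u) U a = occ U a.
Proof. by []. Qed.

Lemma occ_pos w (U : set (wdom w)) s : U s -> (0 < occ U (w s).1)%N.
Proof.
move=> Us; rewrite /occ cardfs_gt0; apply/fset0Pn; exists s.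
by rewrite in_fset_set ?inE //; exact: finite_occ.
Qed.

End Occurrences.

Local Open Scope ring_scope.

(** * Lengths *)

Section Lengths.
Context (A : omegaAlphabet).
Implicit Types (u v w : word A) (g h k : BF A) (a b : A).

Lemma mulbf u v : (bf u * bf v)%g = bf (wcat u v).
Proof. exact: bf_mulE. Qed.

Lemma invbf u : (bf u)^-1%g = bf (winv u).
Proof. exact: bf_invE. Qed.

Lemma reduced_formP g : reduced (reduced_form g) /\ bf (reduced_form g) = g.
Proof.
rewrite /reduced_form; case: xgetP => [w _ //|no].
have [v [wv red_v]] := exists_reduced (repr g).
case: (no v); split=> //; rewrite -[RHS]bf_repr; apply/bfP.
exact/rst_sym/rst_step.
Qed.

Lemma bf_ind (P : BF A -> Prop) :
  (forall w, reduced w -> P (bf w)) -> forall g, P g.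
Proof. by move=> Pw g; have [red_w <-] := reduced_formP g; apply: Pw. Qed.

Lemma LE g a : L g a = (occ (w := reduced_form g) setT a)%:Z.
Proof.
rewrite /L /occ; congr (Posz #|` fset_set _|).
by apply/seteqP; split=> [s|s []].
Qed.

Lemma L_reduced w a : reduced w -> L (bf w) a = (occ (w := w) setT a)%:Z.
Proof.
move=> red_w; rewrite LE; have [red_v /bfP vw] := reduced_formP (bf w).
by rewrite (occ_iso a (reduced_unique red_v red_w vw)).
Qed.

Lemma L_le w a : (L (bf w) a <= (occ (w := w) setT a)%:Z).
Proof.
have [v [wv red_v]] := exists_reduced w.
have -> : bf w = bf v by apply/bfP/rst_step.
rewrite L_reduced // lez_nat; have [T [star [f [_ fm fl _]]]] := arisesE wv.
rewrite -(occ_image setT a (Embedding fm fl)) (occC (f @` setT)).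
exact: leq_addr.
Qed.

Lemma L_restrict w (U : set (wdom w)) a : reduced w ->
    (forall s t r, U s -> U t -> wle s r -> wle r t -> U r) ->
  L (bf (wrestrict U)) a = (occ U a)%:Z.
Proof.
move=> red_w Uconv; rewrite L_reduced ?occ_restrict //.
apply: reduced_convex (sval_embedding U) _ red_w.
move=> s t r sr rt; have Ur := Uconv _ _ _ (svalP s) (svalP t) sr rt.
by exists (exist _ r Ur).
Qed.

Lemma L_initial w (I : set (wdom w)) a : reduced w -> initial I ->
  L (bf (wrestrict I)) a = (occ I a)%:Z.
Proof.
by move=> red_w iI; apply: L_restrict => // s t r _ It _; apply: iI.
Qed.

Lemma L_initialC w (I : set (wdom w)) a : reduced w -> initial I ->
  L (bf (wrestrict (~` I))) a = (occ (~` I) a)%:Z.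
Proof.
move=> red_w iI; apply: L_restrict => // s t r nIs _ sr _ Ir.
by apply: nIs; apply: iI sr.
Qed.

Lemma L_initialD w (I J : set (wdom w)) a : reduced w ->
  initial I -> initial J ->
  L (bf (wrestrict (J `\` I))) a = (occ (J `\` I) a)%:Z.
Proof.
move=> red_w iI iJ; apply: L_restrict => // s t r [_ nIs] [Jt _] sr rt; split.
  exact: iJ rt.
by move=> Ir; apply: nIs; apply: iI sr.
Qed.

Lemma bf_cat_cut u v w (f : wdom u -> wdom w) (g : wdom v -> wdom w) :
    embedding f -> embedding g ->
    (forall s t, wle (f s) (g t) /\ f s <> g t) ->
    (forall r, (exists s, f s = r) \/ (exists t, g t = r)) ->
  bf w = (bf u * bf v)%g.
Proof.
move=> ef eg fg fgs; rewrite mulbf; apply/bfP.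
pose h (s : wdom (wcat u v)) := match s with inl s => f s | inr t => g t end.
apply: (@iso_equiv _ _ (wcat u v) h).
- case=> s [] t /=; rewrite ?(emb_le ef) ?(emb_le eg) //.
    by have [] := fg s t.
  by apply/negP => gf; have [fg1] := fg t s; apply; apply: wle_eq.
- by case=> s /=; rewrite ?(emb_lab ef) ?(emb_lab eg).
- by move=> r; case: (fgs r) => -[s <-]; [exists (inl s) | exists (inr s)].
Qed.

Lemma bf_initialD w (I J : set (wdom w)) : initial I -> initial J -> I `<=` J ->
  bf (wrestrict J) = (bf (wrestrict I) * bf (wrestrict (J `\` I)))%g.
Proof.
move=> iI iJ IJ.
pose f (s : wdom (wrestrict I)) : wdom (wrestrict J) :=
  exist _ (sval s) (IJ _ (svalP s)).
pose g (s : wdom (wrestrict (J `\` I))) : wdom (wrestrict J) :=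
  exist _ (sval s) (svalP s).1.
apply: (@bf_cat_cut _ _ _ f g) => //.
  move=> s t; have [_ nIt] := svalP t; split.
    have [//|ts] := wle_or (f s) (g t).
    by case: nIt; apply: iI (svalP s) ts.
  by move=> /(congr1 sval) /= E; apply: nIt; rewrite -E; apply: svalP.
move=> r; have [Ir|nIr] := pselect (I (sval r)).
  by left; exists (exist _ _ Ir); apply: sval_inj.
right; have JIr : (J `\` I) (sval r) by split=> //; apply: svalP.
by exists (exist _ _ JIr); apply: sval_inj.
Qed.

Lemma bf_initial w (I : set (wdom w)) : initial I ->
  bf w = (bf (wrestrict I) * bf (wrestrict (~` I)))%g.
Proof.
move=> iI; apply: (bf_cat_cut (sval_embedding I) (sval_embedding (~` I))).
  move=> s t; have nIt := svalP t; split.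
    by have [//|ts] := wle_or (sval s) (sval t); case: nIt; apply: iI (svalP s) ts.
  by move=> E; apply: nIt; rewrite -E; apply: svalP.
move=> r; have [Ir|nIr] := pselect (I r); [left|right].
  by exists (exist _ _ Ir).
by exists (exist (~` I) r nIr).
Qed.

Lemma LV g : L g^-1%g = L g.
Proof.
elim/bf_ind: g => w red_w; apply/funext => a.
rewrite invbf L_reduced; last exact: reduced_inv.
by rewrite occ_inv L_reduced.
Qed.

Lemma LM_le g h a : (L (g * h)%g a <= L g a + L h a).
Proof.
elim/bf_ind: g => u red_u; elim/bf_ind: h => v red_v.
rewrite mulbf (le_trans (L_le _ _)) //.
by rewrite occ_catT PoszD (L_reduced _ red_u) (L_reduced _ red_v).
Qed.

Lemma L1 : L (1%g : BF A) = 0.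
Proof.
apply/funext => a; apply/eqP; rewrite eq_le; apply/andP; split.
  apply: (le_trans (L_le (wempty A) a)); rewrite /occ.
  rewrite (_ : [set s | _] = set0) ?fset_set0 ?cardfs0 //.
  by apply/seteqP; split=> // -[].
by rewrite LE.
Qed.

(** This is the tree distance between the vertices [g] and [h], available before the tree is
    studied. *)
Definition bf_dist g h : Zomega A := L (g^-1 * h)%g.

Lemma bf_distM k g h : bf_dist (k * g)%g (k * h)%g = bf_dist g h.
Proof. by rewrite /bf_dist invgM -mulgA mulKg. Qed.

Lemma bf_dist1 g : bf_dist 1%g g = L g.
Proof. by rewrite /bf_dist invg1 mul1g. Qed.

Lemma bf_distMr g h : bf_dist g (g * h)%g = L h.
Proof. by rewrite /bf_dist mulKg. Qed.

Lemma bf_distgg g : bf_dist g g = 0.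
Proof. by rewrite /bf_dist mulVg L1. Qed.

Lemma bf_distC g h : bf_dist g h = bf_dist h g.
Proof. by rewrite /bf_dist -LV invgM invgK. Qed.

Lemma bf_dist_triangle g h k a : bf_dist g k a <= bf_dist g h a + bf_dist h k a.
Proof.
rewrite (le_trans _ (LM_le (g^-1 * h)%g (h^-1 * k)%g a)) //.
by rewrite -mulgA mulVKg.
Qed.

Lemma L_eq0 g : L g = 0 -> g = 1%g.
Proof.
elim/bf_ind: g => w red_w L0; apply/bfP/rst_sym.
have nw (s : wdom w) : False.
  have := @occ_pos _ w setT s I; have := congr1 (@^~ (w s).1) L0.
  by rewrite /= L_reduced // => -[->].
apply: rst_sym; apply: (@iso_equiv _ w (wempty A) (of_void _)) => [[]|[]|r].
by case: (nw r).
Qed.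

(** * Common initial segments and the isosceles inequality *)

Lemma initial_total w (I J : set (wdom w)) :
  initial I -> initial J -> I `<=` J \/ J `<=` I.
Proof.
move=> iI iJ; have [|] := pselect (I `<=` J); first by left.
move=> /existsNP[s /not_implyP[Is nJs]]; right=> t Jt.
have [st|ts] := wle_or s t; first by case: nJs; apply: iJ st.
exact: iI ts.
Qed.

Lemma meet_reduced u v : reduced u -> reduced v ->
  exists (I : set (wdom u)) (J : set (wdom v)),
  [/\ initial I, initial J, bf (wrestrict I) = bf (wrestrict J),
      forall a, occ I a = occ J a &
      forall a, bf_dist (bf u) (bf v) a = (occ (~` I) a + occ (~` J) a)%N%:Z].
Proof.
move=> red_u red_v; have [R [pR maxR]] := maximal_pairing (wcat (winv u) v).
have mR := pairing_matching red_u red_v pR.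
exists (match_dom (fun (s : wdom u) (t : wdom v) => R (inl s) (inr t))).
exists (match_cod (fun (s : wdom u) (t : wdom v) => R (inl s) (inr t))).
split.
- exact: match_dom_initial.
- exact: match_cod_initial.
- exact/bfP/word_iso_equiv/match_iso.
- by move=> a; have /(occ_iso a) := match_iso mR; rewrite !occ_restrict.
move=> a; rewrite /bf_dist invbf mulbf.
have -> : bf (wcat (winv u) v) = bf (wrestrict (w := wcat (winv u) v) (unpaired R)).
  by apply/bfP/rst_step/pairing_arises.
rewrite L_reduced ?occ_restrict; last exact: maximal_pairing_reduced.
have [noL noR] := reduced_cat_across (reduced_inv red_u) red_v pR.
congr Posz; rewrite -(@occ_cat _ (winv u) v); congr occ.
apply/seteqP; split.
  case=> [s|t] nR; [left; exists s => // -[t Rst] | right; exists t => // -[s Rst]].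
    by apply: nR; exists (inr t).
  by apply: nR; exists (inl s); apply: (pair_sym pR).
move=> r [[s ns <-]|[t nt <-]] [[r'|r'] Rr].
- by case: (noL _ _ Rr).
- by apply: ns; exists r'.
- by apply: nt; exists r'; apply: (pair_sym pR).
- by case: (noR _ _ Rr).
Qed.

(** The matched segment is counted in both lengths and absent from the distance, so the division by
    2 in [c] is exact. *)
Lemma c_reduced u v (I : set (wdom u)) (J : set (wdom v)) a :
    reduced u -> reduced v -> occ I a = occ J a ->
    bf_dist (bf u) (bf v) a = (occ (~` I) a + occ (~` J) a)%N%:Z ->
  c (bf u) (bf v) a = (occ I a)%:Z.
Proof.
move=> red_u red_v IJ Luv; rewrite /c -/(bf_dist _ _) Luv.
rewrite (L_reduced _ red_u) (L_reduced _ red_v).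
rewrite (occC I) (occC J) IJ.
by rewrite (_ : (_ - _) = ((occ J a)%:Z * 2)) ?mulzK //; lia.
Qed.

Lemma c_double g h a : c g h a *+ 2 = L g a + L h a - bf_dist g h a.
Proof.
elim/bf_ind: g => u red_u; elim/bf_ind: h => v red_v.
have [I [J [iI iJ _ IJ Luv]]] := meet_reduced red_u red_v.
rewrite (c_reduced red_u red_v (IJ a) (Luv a)) Luv.
rewrite (L_reduced _ red_u) (L_reduced _ red_v).
rewrite (occC I) (occC J) IJ; lia.
Qed.

Lemma c_sym g h : c g h = c h g.
Proof.
apply/funext => a; have := c_double g h a; have := c_double h g a.
by rewrite (bf_distC g); lia.
Qed.

Lemma c_ge0 g h a : 0 <= c g h a.
Proof.
have := c_double g h a; have := bf_dist_triangle g 1%g h a.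
by rewrite (bf_distC g 1%g) !bf_dist1; lia.
Qed.

Lemma c_lel g h a : c g h a <= L g a.
Proof.
by have := c_double g h a; have := bf_dist_triangle 1%g g h a; rewrite !bf_dist1; lia.
Qed.

Lemma cgg g : c g g = L g.
Proof. by apply/funext => a; have := c_double g g a; rewrite bf_distgg /=; lia. Qed.

(** The segments of [v] shared with [u] and with [x] are comparable. Going from [u] to [x] through
    their two end points bounds the distance, hence bounds [c u x] below by the smaller segment. The
    same alternative holds at all coordinates, so it passes to the lexicographic order. *)
Lemma c_isosceles_pointwise g h k :
  (forall a, c g h a <= c g k a) \/ (forall a, c h k a <= c g k a).
Proof.
elim/bf_ind: g => u red_u; elim/bf_ind: h => v red_v.
elim/bf_ind: k => x red_x.
have [I [J [iI iJ IJb IJ Luv]]] := meet_reduced red_u red_v.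
have [I' [J' [iI' iJ' IJb' IJ' Lvx]]] := meet_reduced red_v red_x.
have Pg a : bf_dist (bf u) (bf (wrestrict I)) a = (occ (~` I) a)%:Z.
  by rewrite bf_distC [in LHS](bf_initial iI) bf_distMr L_initialC.
have Qk a : bf_dist (bf (wrestrict I')) (bf x) a = (occ (~` J') a)%:Z.
  by rewrite IJb' (bf_initial iJ') bf_distMr L_initialC.
have L3 a : bf_dist (bf u) (bf x) a <= (occ (~` I) a)%:Z +
    bf_dist (bf (wrestrict I)) (bf (wrestrict I')) a + (occ (~` J') a)%:Z.
  rewrite -Pg -Qk (le_trans (bf_dist_triangle _ (bf (wrestrict I)) _ _)) // -addrA lerD2l.
  exact: bf_dist_triangle.
have [JI' | I'J] := initial_total iJ iI'.
  left=> a; rewrite (c_reduced red_u red_v (IJ a) (Luv a)).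
  have := c_double (bf u) (bf x) a; have := L3 a.
  rewrite (L_reduced _ red_u) (L_reduced _ red_x).
  rewrite IJb (bf_initialD iJ iI' JI') bf_distMr (L_initialD _ red_v iJ iI').
  have := occD a JI'; rewrite (occC I) (occC J') -IJ' -IJ; lia.
right=> a; rewrite (c_reduced red_v red_x (IJ' a) (Lvx a)).
have := c_double (bf u) (bf x) a; have := L3 a.
rewrite (L_reduced _ red_u) (L_reduced _ red_x).
rewrite IJb (bf_initialD iI' iJ I'J) (bf_distC (_ * _)%g) bf_distMr (L_initialD _ red_v iI' iJ).
have := occD a I'J; rewrite (occC I) (occC J') -IJ' -IJ; lia.
Qed.

End Lengths.

(** * The ordered group of lengths *)

Section ZomegaOrder.
Context (A : omegaAlphabet).
Implicit Types r s t : Zomega A.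

Lemma Zle_pointwise s t : (forall a, s a <= t a) -> s <= t.
Proof.
move=> st; rewrite leNgt; apply/negP => /Zomega_ltP[a [ts _]].
by have := st a; rewrite leNgt ts.
Qed.

Lemma Zlt_add2r r s t : (s + r < t + r) = (s < t).
Proof.
apply/Zomega_ltP/Zomega_ltP => -[a [sta eqa]]; exists a; split.
- by move: sta; rewrite ltrD2r.
- by move=> b /eqa /addIr.
- by rewrite ltrD2r.
- by move=> b /eqa E; congr (_ + _).
Qed.

Lemma Zle_add2r r s t : (s + r <= t + r) = (s <= t).
Proof. by rewrite !leNgt Zlt_add2r. Qed.

Lemma Zsub_ge0 s t : (0 <= t - s) = (s <= t).
Proof. by rewrite -(Zle_add2r s 0) add0r subrK. Qed.

Lemma Zsub_gt0 s t : (0 < t - s) = (s < t).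
Proof. by rewrite -(Zlt_add2r s 0) add0r subrK. Qed.

Lemma Zaddr_ge0 s t : 0 <= s -> 0 <= t -> 0 <= s + t.
Proof. by move=> s0 t0; apply: le_trans t0 _; rewrite -[X in X <= _]add0r Zle_add2r. Qed.

Lemma Zaddr_gt0 s t : 0 < s -> 0 <= t -> 0 < s + t.
Proof. by move=> s0 t0; apply: le_lt_trans t0 _; rewrite -[X in X < _]add0r Zlt_add2r. Qed.

End ZomegaOrder.

(** * Letters and initial segments *)

Section Letters.
Context (A : omegaAlphabet).
Implicit Types (u v w : word A) (g h k : BF A) (a b : A) (x y : letter A).

Lemma reduced_letter x : reduced (wletter x).
Proof. by apply/reducedP => R pR [] [] /(pairing_neq pR). Qed.

Lemma occ_set1 w (s : wdom w) a : occ [set s] a = ((w s).1 == a).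
Proof.
rewrite /occ; case: eqVneq => [<- | sa].
  rewrite (_ : [set _ | _] = [set s : {classic wdom w}]) ?fset_set1 ?cardfs1 //.
  by apply/seteqP; split=> [t []|t ->].
rewrite (_ : [set _ | _] = set0) ?fset_set0 ?cardfs0 //.
by apply/seteqP; split=> // t [-> /eqP]; rewrite (negPf sa).
Qed.

Lemma L_letter x a : L (bf_letter x) a = (x.1 == a)%:Z.
Proof.
rewrite (L_reduced _ (@reduced_letter x)) -(occ_set1 (w := wletter x) tt).
by congr (Posz (occ _ _)); apply/seteqP; split=> // -[].
Qed.

Lemma L_letterE x : L (bf_letter x) = L (bf_letter (x.1, false)).
Proof. by apply/funext => a; rewrite !L_letter. Qed.

Lemma bf_letterV x : bf_letter (linv x) = (bf_letter x)^-1%g.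
Proof.
rewrite invbf; apply/bfP.
by apply: (@iso_equiv A (wletter (linv x)) (winv (wletter x))
             (fun s : unit => s)) => [s t|s|s] //; exists s.
Qed.

Lemma bf_letter_inj : injective (@bf_letter A).
Proof.
move=> x y /bfP /(reduced_unique (@reduced_letter x) (@reduced_letter y)).
by case=> phi [_ _ /(_ tt)].
Qed.

Lemma bf_point w (s : wdom w) : bf (wrestrict [set s]) = bf_letter (w s).
Proof.
apply/bfP.
apply: (@iso_equiv A (wrestrict [set s]) (wletter (w s))
          (fun _ : unit => exist [set s] s erefl)).
- by case=> -[]; rewrite /= /wrestrict_le /= wle_refl.
- by [].
- by case=> t ts; exists tt; apply: sval_inj.
Qed.

Lemma L_ends_in g x : ends_in g x ->
  L g = L (g * bf_letter (linv x))%g + L (bf_letter x).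
Proof.
move=> [s [lasts <-]]; set v := reduced_form g in s lasts *.
have [red_v gE] := reduced_formP g; rewrite -/v in red_v gE.
have iI : initial (~` [set s]).
  move=> r t ts rt rs; apply: ts; rewrite /= in rs *.
  by apply: wle_eq => //; rewrite -rs.
have gI : g = (bf (wrestrict (~` [set s])) * bf_letter (v s))%g.
  by rewrite -gE [LHS](bf_initial iI) setCK bf_point.
have gI' : (g * bf_letter (linv (v s)))%g = bf (wrestrict (~` [set s])).
  by rewrite {1}gI bf_letterV mulgK.
apply/funext => a; rewrite gI' -[in LHS]gE (L_reduced _ red_v) (occC [set s]).
have -> : (L (bf (wrestrict (~` [set s]))) + L (bf_letter (v s))) a =
  L (bf (wrestrict (~` [set s]))) a + L (bf_letter (v s)) a by [].
by rewrite (L_initial _ red_v iI) L_letter -occ_set1 PoszD addrC.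
Qed.

(** The product stays reduced: a pair would join some [s] to the added letter, nesting would join
    every later position to it as well, so [s] would be last and carry [linv x]. *)
Lemma L_not_ends_in g x : ~ ends_in g (linv x) ->
  L (g * bf_letter x)%g = L g + L (bf_letter x).
Proof.
rewrite /ends_in; set v := reduced_form g => not_end.
have [red_v gE] := reduced_formP g; rewrite -/v in red_v gE.
have red_vx : reduced (wcat v (wletter x)).
  apply/reducedP => R pR.
  have [noL noR] := reduced_cat_across red_v (@reduced_letter x) pR.
  suff no s t : ~ R (inl s) (inr t).
    move=> [s|s] [t|t] Rst; [exact: (noL _ _ Rst) | exact: (no _ _ Rst) |
      exact: (no _ _ (pair_sym pR Rst)) | exact: (noR _ _ Rst)].
  move=> Rst; apply: not_end; exists s; split=> [r|].
    have [//|sr] := wle_or r s.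
    have [[r'|r'] [Rr _ _]] := pair_nest pR Rst (r := inl r) sr isT.
      by case: (noL _ _ Rr).
    have := pair_fun pR (pair_sym pR Rst) (t' := inl r).
    by case: t r' Rst Rr => -[] Rst Rr /(_ (pair_sym pR Rr)) [->]; rewrite wle_refl.
  by have := pair_lab pR (pair_sym pR Rst).
apply/funext => a; rewrite -gE mulbf (L_reduced _ red_vx) occ_catT.
by rewrite PoszD -(L_reduced _ red_v) -(L_reduced _ (@reduced_letter x)).
Qed.

(** A last position carries only one letter. Hence a vertex has a triple with any prescribed [a],
    for a suitable sign. *)
Lemma ends_in_one g a : exists p, ~ ends_in g (a, ~~ p).
Proof.
have [[s [lasts sE]]|] := pselect (ends_in g (a, true)); last by exists false.
exists true => -[t [lastt tE]]; have ts := wle_eq (lasts t) (lastt s).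
by rewrite -ts tE in sE.
Qed.

(** * Cutting a word at a given length *)

Lemma finite_last w (F : set (wdom w)) : finite_set F -> F !=set0 ->
  exists2 s, F s & forall t, F t -> wle t s.
Proof.
move=> /(@finite_seqP {classic wdom w})[q ->] {F}.
elim: q => [|s q IHq] [r rq] //.
have [[r' r'q]|q0] := pselect ([set` q] !=set0).
  have [m mq mmax] := IHq (ex_intro _ r' r'q).
  have [ms|sm] := wle_or m s.
    exists s; first by rewrite /= mem_head.
    move=> t; rewrite /= in_cons => /orP[/eqP->|/mmax tm]; first exact: wle_refl.
    exact: wle_trans tm ms.
  exists m; first by rewrite /= in_cons (mq : m \in q) orbT.
  by move=> t; rewrite /= in_cons => /orP[/eqP->|/mmax].
exists s; first by rewrite /= mem_head.
move=> t; rewrite /= in_cons => /orP[/eqP->|tq]; first exact: wle_refl.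
by case: q0; exists t.
Qed.

Lemma finite_first w (F : set (wdom w)) : finite_set F -> F !=set0 ->
  exists2 s, F s & forall t, F t -> wle s t.
Proof. exact: (@finite_last (winv w)). Qed.

Lemma finite_upto w a : finite_set [set s | ((w s).1 <= a)%O].
Proof.
apply: (@finite_labels _ w [set x : letter A | (x.1 <= a)%O]).
have [e [[f eK fK] emono]] := alph_omega A.
apply: sub_finite_set (_ : _ `<=` (e @` `I_(f a).+1) `*` [set: bool]) _.
  move=> [b p] /= ba; split=> //; exists (f b); last exact: fK.
  by rewrite /= ltnS -emono !fK.
by apply: finite_setX; [apply/finite_image/finite_II | apply: finite_finset].
Qed.

Lemma occ_sub_eq w (U V : set (wdom w)) a : U `<=` V ->
  (forall s, V s -> ~ U s -> (w s).1 <> a) -> occ U a = occ V a.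
Proof.
move=> UV nVU; rewrite /occ; congr (#|` fset_set _|); apply/seteqP.
split=> s [Us sa]; split=> //; first exact: UV.
by apply: contrapT => /(nVU _ Us).
Qed.

Definition upto w (s : wdom w) : set (wdom w) := [set r | wle r s].

Lemma upto_initial w (s : wdom w) : initial (upto s).
Proof. by move=> r t ts rt; apply: wle_trans rt ts. Qed.

Definition occZ w (U : set (wdom w)) : Zomega A := fun a => (occ U a)%:Z.

Lemma occZ_sub w (U V : set (wdom w)) : U `<=` V -> occZ U <= occZ V.
Proof.
by move=> UV; apply: Zle_pointwise => a; rewrite lez_nat (occD a UV) leq_addr.
Qed.

Definition below w (n : Zomega A) : set (wdom w) := [set s | occZ (upto s) <= n].
Arguments below : clear implicits.

Lemma below_initial w n : initial (below w n).
Proof.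
move=> r s sn rs; apply: le_trans (occZ_sub _) sn => t tr.
exact: wle_trans tr rs.
Qed.

(** The set [below w n] may have no last position. If its length first exceeds [n] at the letter
    [a], the last of its finitely many positions with letters up to [a] has a prefix with the same
    counts up to [a], which exceeds [n] too. *)
Lemma occZ_below w n : 0 <= n -> occZ (below w n) <= n.
Proof.
move=> n0; rewrite leNgt; apply/negP => /Zomega_ltP[a [na eqa]].
pose F := [set s | ((w s).1 <= a)%O] `&` below w n.
have [F0|nF0] := pselect (F !=set0); last first.
  (* With no such position the counts up to [a] vanish, which forces [n] to be negative. *)
  have N0 b : (b <= a)%O -> occZ (below w n) b = 0.
    move=> ba; rewrite /occZ -(@occ_sub_eq w set0) // => [|s Is _ sb].
      rewrite /occ (_ : [set _ | _] = set0) ?fset_set0 ?cardfs0 //.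
      by apply/seteqP; split=> // t [].
    by apply: nF0; exists s; split=> //=; rewrite sb.
  move: n0; rewrite leNgt => /negP; apply; apply/Zomega_ltP; exists a.
  split; first by rewrite (N0 a) // in na.
  by move=> b ba; rewrite eqa // N0 // ltW.
have [s [sa Is] smax] := finite_last (finite_setIl _ (finite_upto w a)) F0.
move: (Is); rewrite /below /= leNgt => /negP; apply; apply/Zomega_ltP; exists a.
have E b : (b <= a)%O -> occZ (upto s) b = occZ (below w n) b.
  move=> ba; congr Posz; apply: occ_sub_eq => [r rs|r Ir nrs rb].
    exact: below_initial Is rs.
  by apply: nrs; apply: smax; split=> //=; rewrite rb.
by split=> [|b ba]; rewrite E // ?eqa // ltW.
Qed.

(** Let [a] be the first letter where the cut falls short of [n], and [s] the first position outside
    the cut with a letter up to [a]. A prefix ending before [s] has the counts of the cut up to [a],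
    so it is still shorter than [n]: nothing lies between the cut and [s]. *)
Lemma first_above w n : occZ (below w n) < n -> n <= occZ (w := w) setT ->
  exists s, ~ below w n s /\ upto s `\` below w n = [set s].
Proof.
move=> /Zomega_ltP[a [na eqa]] nT.
pose F := [set s | ((w s).1 <= a)%O] `&` ~` below w n.
have F0 : F !=set0.
  apply: contrapT => F0.
  have N b : (b <= a)%O -> occZ (below w n) b = occZ (w := w) setT b.
    move=> ba; congr Posz; apply: occ_sub_eq => // s _ nIs sb.
    by apply: F0; exists s; split=> //=; rewrite sb.
  move: nT; rewrite leNgt => /negP; apply; apply/Zomega_ltP; exists a.
  by split=> [|b ba]; rewrite -N // ?eqa // ltW.
have [s [sa nIs] smin] := finite_first (finite_setIl _ (finite_upto w a)) F0.
have firsts r : ~ below w n r -> wle s r.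
  move=> nIr; apply: contrapT => nsr; apply: (nIr); apply: ltW.
  apply/Zomega_ltP; exists a.
  have E b : (b <= a)%O -> occZ (upto r) b = occZ (below w n) b.
    move=> ba; congr Posz; apply/esym/occ_sub_eq => [t It|t tr nIt tb].
      have [//|rt] := wle_or t r.
      by case: nIr; apply: below_initial It rt.
    apply: nsr; apply: wle_trans tr; apply: smin; split=> //=; by rewrite tb.
  by split=> [|b ba]; rewrite E // ?eqa // ltW.
exists s; split=> //; apply/seteqP; split=> [t [ts nIt]|t ->].
  by apply: wle_eq => //; apply: firsts.
by split=> //; apply: wle_refl.
Qed.

(** The two cases give the triples with [t = 0] and with [t > 0]: in the second, [n] falls strictly
    inside the edge from the prefix [h] to [h x]. *)
Lemma cut g (n : Zomega A) : 0 <= n -> n <= L g ->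
  exists h, L g = L h + bf_dist h g /\
    (n = L h \/ exists x, [/\ L (h * bf_letter x)%g = L h + L (bf_letter x),
       L g = L (h * bf_letter x)%g + bf_dist (h * bf_letter x)%g g,
       L h < n & n < L h + L (bf_letter x)]).
Proof.
elim/bf_ind: g => v red_v n0; have -> : L (bf v) = occZ (w := v) setT.
  by apply/funext => a; rewrite L_reduced.
move=> nv; have pre (I : set (wdom v)) : initial I ->
    L (bf (wrestrict I)) = occZ I /\ bf_dist (bf (wrestrict I)) (bf v) = occZ (~` I).
  move=> iI; split; apply/funext => a; first exact: L_initial.
  by rewrite [in LHS](bf_initial iI) bf_distMr; apply: L_initialC.
have split_occ (I : set (wdom v)) : occZ (w := v) setT = occZ I + occZ (~` I).
  by apply/funext => a; rewrite /occZ (occC I) PoszD.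
have iI := @below_initial v n; have [LI DI] := pre _ iI.
exists (bf (wrestrict (below v n))); rewrite LI DI; split=> //.
have := occZ_below v n0; rewrite le_eqVlt => /orP[/eqP->|In]; first by left.
right; have [s [ns sE]] := first_above In nv; exists (v s).
have iJ := @upto_initial v s; have [LJ DJ] := pre _ iJ.
have IJ : below v n `<=` upto s.
  by move=> t It; have [//|/(below_initial It)/ns] := wle_or t s.
have wx : (bf (wrestrict (below v n)) * bf_letter (v s))%g = bf (wrestrict (upto s)).
  by rewrite (bf_initialD iI iJ IJ) sE bf_point.
have E : occZ (upto s) = occZ (below v n) + L (bf_letter (v s)).
  apply/funext => a; rewrite /occZ (occD a IJ) sE occ_set1 PoszD.
  by rewrite -(L_letter (v s)).
rewrite wx LJ DJ; split; [exact: E | exact: split_occ | exact: In |].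
by rewrite -E ltNge; apply/negP.
Qed.

End Letters.

(** * Linear arithmetic in the lexicographic group *)

Section ZomegaLinear.
Context (A : omegaAlphabet).
Implicit Types r s t : Zomega A.

Lemma ZaddE s t a : (s + t) a = s a + t a. Proof. by []. Qed.
Lemma ZoppE s a : (- s) a = - s a. Proof. by []. Qed.
Lemma ZzeroE a : (0 : Zomega A) a = 0. Proof. by []. Qed.
Lemma Zmuln2E s a : (s *+ 2) a = s a + s a. Proof. by rewrite mulr2n. Qed.

(** Lexicographic inequalities cannot be checked by coordinates. These lemmas take the inequalities
    to be added and leave an equation, which can. *)
Lemma Zle_lin1 s t s1 t1 : s1 <= t1 -> t - s = t1 - s1 -> s <= t.
Proof. by rewrite -Zsub_ge0 => + E; rewrite -E Zsub_ge0. Qed.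

Lemma Zlt_lin1 s t s1 t1 : s1 < t1 -> t - s = t1 - s1 -> s < t.
Proof. by rewrite -Zsub_gt0 => + E; rewrite -E Zsub_gt0. Qed.

Lemma Zle_lin2 s t s1 t1 s2 t2 :
  s1 <= t1 -> s2 <= t2 -> t - s = (t1 - s1) + (t2 - s2) -> s <= t.
Proof.
rewrite -Zsub_ge0 -(Zsub_ge0 s2) => H1 H2 E.
by rewrite -Zsub_ge0 E Zaddr_ge0.
Qed.

Lemma Zlt_lin2 s t s1 t1 s2 t2 :
  s1 < t1 -> s2 <= t2 -> t - s = (t1 - s1) + (t2 - s2) -> s < t.
Proof.
rewrite -Zsub_gt0 -(Zsub_ge0 s2) => H1 H2 E.
by rewrite -Zsub_gt0 E Zaddr_gt0.
Qed.

End ZomegaLinear.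

(** Evaluates the equations of the context and the goal at one coordinate for [lia]; inequalities
    are discarded, being lexicographic. *)
Ltac zeq :=
  let a := fresh "a" in
  apply/funext => a;
  repeat match goal with
  | H : @eq _ _ _ |- _ =>
      move: (congr1 (fun f : Zomega _ => f a) H); clear H
  end;
  repeat match goal with
  | H : ?P |- _ => lazymatch type of P with Prop => clear H end
  end;
  rewrite /= ?(ZaddE, ZoppE, ZzeroE, Zmuln2E); lia.

(** * The metric of the tree *)

Section Points.
Context (A : omegaAlphabet).
Implicit Types (g h k u w : BF A) (a b : A) (x : letter A) (n m s t : Zomega A).

Lemma bf_dist_c g h : bf_dist g h = L g + L h - (c g h + c g h).
Proof. by apply/funext => a; have := c_double g h a; rewrite !(ZaddE, ZoppE); lia. Qed.

Lemma bf_dist_ge0 g h a : 0 <= bf_dist g h a.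
Proof. by have := bf_dist_triangle g h g a; rewrite bf_distgg (bf_distC h) ZzeroE; lia. Qed.

Lemma bf_dist_eq0 g h : bf_dist g h = 0 -> g = h.
Proof. by move=> /L_eq0 gh; rewrite -[g]mulg1 -gh mulVKg. Qed.

Lemma c_nonneg g h : 0 <= c g h.
Proof. by apply: Zle_pointwise => a; apply: c_ge0. Qed.

Lemma c_leL g h : c g h <= L g.
Proof. by apply: Zle_pointwise => a; apply: c_lel. Qed.

Lemma c_leR g h : c g h <= L h.
Proof. by rewrite c_sym c_leL. Qed.

Lemma L_nonneg g : 0 <= L g.
Proof. by rewrite -cgg c_nonneg. Qed.

Lemma c_isosceles g h k n : n <= c g h -> n <= c h k -> n <= c g k.
Proof.
move=> ngh nhk; have [ghk|hgk] := c_isosceles_pointwise g h k.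
  exact: le_trans ngh (Zle_pointwise ghk).
exact: le_trans nhk (Zle_pointwise hgk).
Qed.

Lemma c_isosceles_lt g h k n : n < c g h -> n < c h k -> n < c g k.
Proof.
move=> ngh nhk; have [le|/ltW le] := leP (c g h) (c h k).
  exact: lt_le_trans ngh (c_isosceles (lexx _) le).
exact: lt_le_trans nhk (c_isosceles le (lexx _)).
Qed.

Lemma c_prefix g h : L h = L g + bf_dist g h -> c g h = L g.
Proof. by move=> E; have F := bf_dist_c g h; zeq. Qed.

Definition valid g n := 0 <= n <= L g.

Lemma ptE g n (vn : valid g n) : pt n g = \pi_(tree A) (exist _ (g, n) vn : tree_pre A).
Proof. by rewrite /pt; congr (\pi_(tree A) _); apply: val_inj; rewrite insubdK. Qed.

(** Transitivity of [tree_ident] is the isosceles inequality, so generating an equivalence adds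
    nothing. *)
Lemma tree_ident_equiv (p q : tree_pre A) :
  clos_refl_sym_trans (tree_pre A) (@tree_ident A) p q <-> tree_ident p q.
Proof.
split; last exact: rst_step.
elim=> {p q} [p q // | p | p q _ [E le] | p q r _ [E1 le1] _ [E2 le2]].
- by split; rewrite // cgg; case/andP: (valP p).
- by split; rewrite -?E // c_sym.
- split; first by rewrite E1.
  by apply: c_isosceles le1 _; rewrite E1.
Qed.

Lemma pt_eq g h n m : valid g n -> valid h m ->
  pt n g = pt m h <-> n = m /\ n <= c g h.
Proof.
move=> vn vm; rewrite (ptE vn) (ptE vm); split.
  by move=> /eqP; rewrite eqmodE => /asboolP/tree_ident_equiv.
by move=> E; apply/eqP; rewrite eqmodE; apply/asboolP/tree_ident_equiv.
Qed.

Lemma tree_pt (x : tree A) : exists g n, valid g n /\ x = pt n g.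
Proof.
have := reprK x; case: (repr x) => -[g n] vn /= <-.
by exists g, n; rewrite (ptE (vn : valid g n)).
Qed.

(** By the isosceles inequality the representatives chosen by [repr] give the same minimum. The
    caller supplies that minimum as [y]. *)
Lemma dist_eval g h n m y : valid g n -> valid h m ->
    y <= n -> y <= m -> y <= c g h -> [\/ y = n, y = m | y = c g h] ->
  dist (pt n g) (pt m h) = n + m - (y + y).
Proof.
move=> vn vm yn ym yc yor; rewrite /dist.
have reprP k r (vr : valid k r) : exists k', val (repr (pt r k)) = (k', r) /\ r <= c k k'.
  have : pt r k = \pi_(tree A) (repr (pt r k)) by rewrite reprK.
  case: (repr (pt r k)) => -[k' r'] vr' /=.
  rewrite -(ptE (vr' : valid k' r')) => /(pt_eq vr vr')[/= <- rc].
  by exists k'.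
have [g' [-> ng]] := reprP _ _ vn; have [h' [-> mh]] := reprP _ _ vm.
suff -> : Order.min n (Order.min m (c g' h')) = y by rewrite mulr2n.
have cE z : z <= n -> z <= m -> (z <= c g' h') = (z <= c g h).
  move=> zn zm; have zg := le_trans zn ng; have zh := le_trans zm mh.
  apply/idP/idP => zc.
    by apply: c_isosceles zg _; apply: c_isosceles zc _; rewrite c_sym.
  rewrite c_sym in zg; apply: c_isosceles zg _; exact: c_isosceles zc zh.
apply: le_anti; rewrite !le_min yn ym cE // yc !andbT /=.
set z := Order.min _ _.
have [zn zm zc] : [/\ z <= n, z <= m & z <= c g' h'].
  by rewrite /z !ge_min !lexx !orbT.
by case: yor => ->; rewrite // -cE.
Qed.

Lemma valid_L g : valid g (L g).
Proof. by rewrite /valid lexx L_nonneg. Qed.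

Lemma dist_sym (x y : tree A) : dist x y = dist y x.
Proof.
have [g [n [vn ->]]] := tree_pt x; have [h [m [vm ->]]] := tree_pt y.
pose z := Order.min n (Order.min m (c g h)).
have [zn zm zc] : [/\ z <= n, z <= m & z <= c g h].
  by rewrite /z !ge_min !lexx !orbT.
have zor : [\/ z = n, z = m | z = c g h].
  rewrite /z; case: (leP n) => _; first by constructor 1.
  by case: (leP m) => _; [constructor 2 | constructor 3].
rewrite (dist_eval vn vm zn zm zc zor) (@dist_eval _ _ _ _ z vm vn) //.
- by rewrite (addrC n).
- by rewrite c_sym.
- by rewrite c_sym; case: zor; [constructor 2 | constructor 1 | constructor 3].
Qed.

(** * Segments between vertices *)

(** The path from [h] to [k] descends towards the root to height [c h k], then climbs towards [k].
    On the second leg the height is [c h k + (n - (L h - c h k))]. *)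
Definition geo h k n : tree A :=
  if n <= L h - c h k then pt (L h - n) h else pt (n - L h + (c h k + c h k)) k.

Variant geo_spec h k n : tree A -> Prop :=
  | GeoLeft of n <= L h - c h k & valid h (L h - n) & c h k <= L h - n :
      geo_spec h k n (pt (L h - n) h)
  | GeoRight of L h - c h k < n & valid k (n - L h + (c h k + c h k))
      & c h k <= n - L h + (c h k + c h k) :
      geo_spec h k n (pt (n - L h + (c h k + c h k)) k).

Lemma geoP h k n : 0 <= n -> n <= bf_dist h k -> geo_spec h k n (geo h k n).
Proof.
have DE := bf_dist_c h k; move=> n0 nD; rewrite /geo; case: leP => nL.
  constructor=> //; last by apply: (Zle_lin1 nL); zeq.
  apply/andP; split; last by apply: (Zle_lin1 n0); zeq.
  by apply: (Zle_lin2 nL (c_nonneg h k)); zeq.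
have nL' := ltW nL; constructor=> //; last by apply: (Zle_lin1 nL'); zeq.
apply/andP; split; last by apply: (Zle_lin1 nD); zeq.
by apply: (Zle_lin2 nL' (c_nonneg h k)); zeq.
Qed.

Lemma geo0 h k : geo h k 0 = vertex h.
Proof.
rewrite /geo ifT ?subr0 //.
by apply: (Zle_lin1 (c_leL h k)); zeq.
Qed.

Lemma geo_end h k : geo h k (bf_dist h k) = vertex k.
Proof.
have DE := bf_dist_c h k.
have D0 : 0 <= bf_dist h k by apply: Zle_pointwise => a; apply: bf_dist_ge0.
have [Dh v _ | _ _ _] := geoP D0 (lexx _).
  apply/(pt_eq v (valid_L k)).
  have Lk : L k = c h k.
    apply: le_anti; rewrite c_leR andbT; apply: (Zle_lin1 Dh); zeq.
  have E : L h - bf_dist h k = L k by zeq.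
  by rewrite E [X in _ <= X](_ : _ = L k).
by congr pt; zeq.
Qed.

Lemma geo_isometry h k s t : 0 <= s <= bf_dist h k -> 0 <= t <= bf_dist h k ->
  dist (geo h k s) (geo h k t) = Order.max (s - t) (t - s).
Proof.
wlog st : s t / s <= t => [hwlog vs vt|].
  have [st|/ltW ts] := leP s t; first exact: hwlog.
  by rewrite dist_sym maxC; apply: hwlog.
move=> /andP[s0 sD] /andP[t0 tD].
have -> : Order.max (s - t) (t - s) = t - s.
  by apply/max_idPr; apply: (Zle_lin2 st st); zeq.
case: geoP => // sL vs cs; case: geoP => // tL vt ct.
- rewrite (@dist_eval _ _ _ _ (L h - t) vs vt) ?cgg //.
  + zeq.
  + by apply: (Zle_lin1 st); zeq.
  + by apply: (Zle_lin1 t0); zeq.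
  + by constructor 2.
- rewrite (@dist_eval _ _ _ _ (c h k) vs vt) //; first zeq.
  by constructor 3.
- by have := lt_le_trans sL (le_trans st tL); rewrite ltxx.
- rewrite (@dist_eval _ _ _ _ (s - L h + (c h k + c h k)) vs vt) ?cgg //.
  + zeq.
  + by apply: (Zle_lin1 st); zeq.
  + by case/andP: vs.
  + by constructor 1.
Qed.

Lemma geo_segment h k n : 0 <= n <= bf_dist h k ->
  segment (vertex h) (vertex k) (geo h k n) /\ dist (vertex h) (geo h k n) = n.
Proof.
move=> /[dup] nD /andP[n0 nD'].
have D0 : 0 <= bf_dist h k by apply: le_trans nD'.
split; last first.
  rewrite -(geo0 h k) geo_isometry ?lexx //.
  rewrite subr0 sub0r; apply/max_idPr; apply: (Zle_lin2 n0 n0); zeq.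
exists (geo h k @` [set s | 0 <= s <= bf_dist h k]); last by exists n.
exists 0, (bf_dist h k), (geo h k); split=> //.
- exact: geo_isometry.
- exact: geo0.
- exact: geo_end.
Qed.

Lemma segment_dist (x y z : tree A) : segment x y z ->
  dist x y = dist x z + dist z y.
Proof.
move=> [_ [a [b [f [ab fd -> <- <-]]]] [s sab <-]].
have /andP[as_ sb] := sab.
have maxE (p q : Zomega A) : p <= q -> Order.max (p - q) (q - p) = q - p.
  by move=> pq; apply/max_idPr; apply: (Zle_lin2 pq pq); zeq.
by rewrite !fd ?lexx ?ab // !maxE //; zeq.
Qed.

(** Additivity of distances gives [p1 + p2 = m + c h k]. The smaller of [p1] and [p2] is at most
    [c h k] by the isosceles inequality and the other at most [m], so both are equalities and [y]
    lies on one of the two legs. *)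
Lemma segment_geo h k y : segment (vertex h) (vertex k) y ->
  y = geo h k (dist (vertex h) y).
Proof.
move=> /segment_dist; have [q [m [vm ->]]] := tree_pt y => Edist.
have vh := valid_L h; have vk := valid_L k; have /andP[m0 mq] := vm.
pose p1 := Order.min m (c h q); pose p2 := Order.min m (c q k).
have minP n e : [/\ Order.min n e <= n, Order.min n e <= e &
    Order.min n e = n \/ Order.min n e = e].
  by rewrite !ge_min !lexx orbT; split=> //; case: leP; [left | right].
have [p1m p1c p1or] := minP m (c h q); have [p2m p2c p2or] := minP m (c q k).
rewrite -/p1 in p1m p1c p1or; rewrite -/p2 in p2m p2c p2or.
clearbody p1 p2.
have E1 : dist (vertex h) (pt m q) = L h + m - (p1 + p1).
  apply: dist_eval => //; first exact: le_trans p1c (c_leL _ _).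
  by case: p1or; [constructor 2 | constructor 3].
have E2 : dist (pt m q) (vertex k) = m + L k - (p2 + p2).
  apply: dist_eval => //; first exact: le_trans p2c (c_leR _ _).
  by case: p2or; [constructor 1 | constructor 3].
have E3 : dist (vertex h) (vertex k) = L h + L k - (c h k + c h k).
  apply: dist_eval => //; [exact: c_leL | exact: c_leR | by constructor 3].
have S : p1 + p2 = m + c h k.
  rewrite E1 E2 E3 in Edist; zeq.
rewrite E1; have [p12|/ltW p21] := leP p1 p2.
  have p1e : p1 <= c h k by apply: (@c_isosceles _ q) => //; apply: le_trans p2c.
  have p2E : p2 = m by apply: le_anti; rewrite p2m /=; apply: (Zle_lin1 p1e); zeq.
  have p1E : p1 = c h k by zeq.
  rewrite p2E in p2c.
  have mk : valid k m by rewrite /valid m0 (le_trans p2c (c_leR _ _)).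
  have -> : pt m q = pt m k by apply/(pt_eq vm mk).
  (* At the meeting point [geo] uses the leg of [h], so the two descriptions of that point have to
     be identified. *)
  rewrite p1E in p1m *; rewrite /geo; case: leP => Hle.
    have E : m = c h k by apply: le_anti; rewrite p1m andbT; apply: (Zle_lin1 Hle); zeq.
    have mh : valid h m by rewrite /valid m0 E c_leL.
    have -> : L h - (L h + m - (c h k + c h k)) = m by zeq.
    by apply/(pt_eq mk mh); rewrite E c_sym.
  by congr pt; zeq.
have p2e : p2 <= c h k by apply: (@c_isosceles _ q) => //; apply: le_trans p1c.
have p1E : p1 = m by apply: le_anti; rewrite p1m /=; apply: (Zle_lin1 p2e); zeq.
have p2E : p2 = c h k by zeq.
rewrite p1E in p1c; rewrite p2E in p2m.
have mh : valid h m by rewrite /valid m0 (le_trans p1c (c_leL _ _)).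
have -> : pt m q = pt m h by apply/(pt_eq vm mh); rewrite c_sym.
rewrite p1E /geo ifT; last by apply: (Zle_lin1 p2m); zeq.
by congr pt; zeq.
Qed.

(** * The action *)

(** Independence of the action from the representative of a point. Left invariance of [bf_dist]
    expresses [c k k'] by [c u k], [c u k'] and [c g g']; if the two points lay on different legs,
    the strict isosceles inequality would fail. *)
Lemma geo_translate u g g' n : 0 <= n -> n <= c g g' ->
  geo u (u * g)%g n = geo u (u * g')%g n.
Proof.
move=> n0 nc; set k := (u * g)%g; set k' := (u * g')%g.
have Dk : bf_dist u k = L g by rewrite /k bf_distMr.
have Dk' : bf_dist u k' = L g' by rewrite /k' bf_distMr.
have Dkk' : bf_dist k k' = bf_dist g g' by rewrite /k /k' bf_distM.
have E1 := bf_dist_c u k; have E2 := bf_dist_c u k'.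
have E3 := bf_dist_c k k'; have E4 := bf_dist_c g g'.
have ck : c k k' = c u k + c u k' - L u + c g g' by zeq.
have nk : n <= bf_dist u k by rewrite Dk (le_trans nc (c_leL _ _)).
have nk' : n <= bf_dist u k' by rewrite Dk' (le_trans nc (c_leR _ _)).
clear Dk Dk' Dkk' E1 E2 E3 E4.
case: (geoP n0 nk) => nL v cn; case: (geoP n0 nk') => nL' v' cn' //.
- have lt1 : c u k < c k' k by rewrite (c_sym k'); apply: (Zlt_lin2 nL' nc); zeq.
  have lt2 : c u k < c u k' by apply: (Zlt_lin2 nL' nL); zeq.
  by have := c_isosceles_lt lt2 lt1; rewrite ltxx.
- have lt1 : c u k' < c k k' by apply: (Zlt_lin2 nL nc); zeq.
  have lt2 : c u k' < c u k by apply: (Zlt_lin2 nL nL'); zeq.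
  by have := c_isosceles_lt lt2 lt1; rewrite ltxx.
- have lt1 : c u k < c k k' by apply: (Zlt_lin2 nL' nc); zeq.
  have lt2 : c u k' < c k k' by apply: (Zlt_lin2 nL nc); zeq.
  have E : c u k = c u k'.
    apply: le_anti; rewrite (c_isosceles (lexx _) (ltW lt1)) /=.
    by apply: (@c_isosceles _ k' _ _ (lexx _)); rewrite (c_sym k') ltW.
  apply/(pt_eq v v'); rewrite E; split=> //.
  by apply: (Zle_lin1 nc); zeq.
Qed.

Lemma act_pt u g n : valid g n -> act u (pt n g) = geo u (u * g)%g n.
Proof.
move=> vn; rewrite /act; have /andP[n0 nL] := vn;
case: xgetP => [y _ /(_ n g vn erefl)[]|no].
  by move=> /segment_geo + yn; rewrite yn.
(* The condition defining [act] ranges over all representatives, so the candidate has to satisfy it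
   for each of them. *)
case: (no (geo u (u * g)%g n)) => m h vm /(pt_eq vn vm)[<- nc].
rewrite (geo_translate u n0 nc); apply: geo_segment.
by rewrite bf_distMr n0 (le_trans nc (c_leR _ _)).
Qed.

(** * Triples *)

Lemma geo_right u k n : L u - c u k < n ->
  geo u k n = pt (n - L u + (c u k + c u k)) k.
Proof. by move=> nL; rewrite /geo leNgt nL. Qed.

Lemma geo_left u k n : n <= L u - c u k -> geo u k n = pt (L u - n) u.
Proof. by rewrite /geo => ->. Qed.

Lemma L_letter_neq0 x : L (bf_letter x) <> 0.
Proof. by move/(congr1 (fun f : Zomega A => f x.1)); rewrite L_letter eqxx. Qed.

Lemma ends_inP g x : ends_in g (linv x) <->
  L g = L (g * bf_letter x)%g + L (bf_letter x).
Proof.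
split=> [/L_ends_in | E].
  rewrite linvK => ->; congr (_ + _); by rewrite L_letterE [RHS]L_letterE.
apply: contrapT => /L_not_ends_in F; apply: (@L_letter_neq0 x); zeq.
Qed.

Lemma not_ends_inP g x : ~ ends_in g (linv x) <->
  L (g * bf_letter x)%g = L g + L (bf_letter x).
Proof.
split=> [/L_not_ends_in // | E] /ends_inP F.
apply: (@L_letter_neq0 x); zeq.
Qed.

Lemma c_mulr g h : L (g * h)%g = L g + L h -> c g (g * h)%g = L g.
Proof. by move=> E; apply: c_prefix; rewrite bf_distMr. Qed.

Lemma triple_valid g x t : ~ ends_in g (linv x) -> 0 <= t < L (bf_letter x) ->
  valid (g * bf_letter x)%g (L g + t).
Proof.
move=> /L_not_ends_in E /andP[t0 tx]; rewrite /valid E; apply/andP; split.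
  exact: Zaddr_ge0 (L_nonneg g) t0.
by apply: (Zle_lin1 (ltW tx)); zeq.
Qed.

Lemma triple_vertex g x : ~ ends_in g (linv x) -> triple g x 0 = vertex g.
Proof.
move=> nx; have := L_not_ends_in nx => E; rewrite /triple addr0.
apply/pt_eq; [|exact: valid_L|by split=> //; rewrite c_sym c_mulr].
by rewrite /valid L_nonneg E; apply: (Zle_lin1 (L_nonneg (bf_letter x))); zeq.
Qed.

(** The distances from [g] to [g'] and from [g'] to [g x] are nonnegative at every coordinate and
    add up to the length of a letter, which is 1 at a single coordinate. So one of them vanishes. *)
Lemma prefix_between_atom g g' x :
    c g (g * bf_letter x)%g = L g -> c g' (g * bf_letter x)%g = L g' ->
    L (g * bf_letter x)%g = L g + L (bf_letter x) -> L g <= L g' ->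
  g' = g \/ g' = (g * bf_letter x)%g.
Proof.
set h := (g * _)%g => cg cg' Lh le.
have cgg' : c g g' = L g.
  apply: le_anti; rewrite c_leL /=; apply: (@c_isosceles _ h); rewrite ?cg //.
  by rewrite c_sym cg'.
have D1 : bf_dist g g' = L g' - L g by have := bf_dist_c g g' => E; zeq.
have D2 : bf_dist g' h = L h - L g' by have := bf_dist_c g' h => E; zeq.
clearbody h.
have [/bf_dist_eq0 ->|D0] := pselect (bf_dist g g' = 0); first by left.
right; apply/esym; rewrite -[LHS](@bf_dist_eq0 g' h) //; apply/funext => b.
have [a Da] : exists a, bf_dist g g' a <> 0.
  apply: contrapT => no; apply: D0; apply/funext => a.
  by apply: contrapT => Da; apply: no; exists a.
have S e : bf_dist g g' e + bf_dist g' h e = (x.1 == e)%:Z.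
  by rewrite D1 D2 Lh -L_letter !(ZaddE, ZoppE); lia.
have P1 e := bf_dist_ge0 g g' e; have P2 e := bf_dist_ge0 g' h e.
have xa : x.1 = a.
  apply/eqP; apply: contrapT => /negP/negPf xa; have := S a; rewrite xa.
  have := P1 a; have := P2 a; lia.
have := S b; have := P1 b; have := P2 b; rewrite ZzeroE.
have [xb|_] := eqVneq x.1 b; last by lia.
rewrite -xb xa; have := S a; have := P1 a; have := P2 a; rewrite xa eqxx; lia.
Qed.

Lemma triple_inj g g' x x' t t' :
    ~ ends_in g (linv x) -> 0 <= t < L (bf_letter x) ->
    ~ ends_in g' (linv x') -> 0 <= t' < L (bf_letter x') ->
    triple g x t = triple g' x' t' ->
  [/\ g = g', t = t' & t <> 0 -> x = x'].
Proof.
move=> nx tx nx' tx' /(pt_eq (triple_valid nx tx) (triple_valid nx' tx')).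
have Lx := L_not_ends_in nx; have Lx' := L_not_ends_in nx'.
have cx := c_mulr Lx; have cx' := c_mulr Lx'.
move: tx tx' => /andP[t0 tx] /andP[t0' tx'] [E nc].
have lt : L g + t < L (g * bf_letter x)%g by rewrite Lx; apply: (Zlt_lin1 tx); zeq.
have lt' : L g + t < L (g' * bf_letter x')%g.
  by rewrite Lx' E; apply: (Zlt_lin1 tx'); zeq.
have gn : L g <= L g + t by apply: (Zle_lin1 t0); zeq.
have gn' : L g' <= L g + t by rewrite E; apply: (Zle_lin1 t0'); zeq.
(* The longer of [g], [g'] is a prefix of the other's edge, hence one of its ends; [t < L x]
   excludes the far end. *)
have gg' : g = g'.
  have [le|/ltW le] := leP (L g) (L g').
    have cgh : c g' (g * bf_letter x)%g = L g'.
      apply: le_anti; rewrite c_leL /=; apply: (@c_isosceles _ (g' * bf_letter x')%g).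
        by rewrite cx'.
      by rewrite c_sym (le_trans gn' nc).
    have [//|gh] := prefix_between_atom cx cgh Lx le.
    by move: lt; rewrite -gh ltNge gn'.
  have cgh : c g (g' * bf_letter x')%g = L g.
    apply: le_anti; rewrite c_leL /=; apply: (@c_isosceles _ (g * bf_letter x)%g).
      by rewrite cx.
    exact: le_trans gn nc.
  have [//|gh] := prefix_between_atom cx' cgh Lx' le.
  by move: lt'; rewrite -gh ltNge gn.
subst g'; have tt' : t = t' by apply: (addrI (L g)).
split=> // tn0; apply: bf_letter_inj; apply: (@mulgI _ g); apply: bf_dist_eq0.
set h := (g * bf_letter x)%g in Lx cx nc *.
set h' := (g * bf_letter x')%g in Lx' cx' nc *.
(* Coordinatewise [c h h'] lies between [L g] and [L g] plus one letter. As [t > 0] it is not [L g],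
   so it equals both [L h] and [L h'], and [h = h']. *)
have Lc e : L g e <= c h h' e.
  by have [/(_ e)|/(_ e)] := c_isosceles_pointwise h g h'; rewrite ?(c_sym h g) ?cx ?cx'.
have [a ca] : exists a, c h h' a <> L g a.
  apply: contrapT => no; apply: tn0; apply: le_anti; rewrite t0 andbT.
  have ch : c h h' = L g.
    by apply/funext => a; apply: contrapT => ca; apply: no; exists a.
  by rewrite ch in nc; apply: (Zle_lin1 nc); zeq.
have lx e : c h h' e <= L g e + (x.1 == e)%:Z.
  by rewrite -L_letter -ZaddE -Lx c_lel.
have lx' e : c h h' e <= L g e + (x'.1 == e)%:Z.
  by rewrite -L_letter -ZaddE -Lx' c_sym c_lel.
have xa : x.1 = a by apply/eqP; have := lx a; have := Lc a; case: eqP => //; lia.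
have xa' : x'.1 = a by apply/eqP; have := lx' a; have := Lc a; case: eqP => //; lia.
apply/funext => b; rewrite bf_dist_c !(ZaddE, ZoppE) Lx Lx' !ZaddE !L_letter.
have := Lc b; have := lx b; rewrite xa xa'.
case: eqP => [<-|_]; have := Lc a; have := lx a; rewrite xa eqxx; lia.
Qed.

Lemma triple_exists (y : tree A) : exists g (a : A) p t,
  [/\ ~ ends_in g (linv (a, p)), 0 <= t < L (bf_letter (a, p)) & triple g (a, p) t = y].
Proof.
have [h [n [vn ->]]] := tree_pt y; have /andP[n0 nL] := vn.
have [g [Lh [ng|[[a p] [Lx Lhx gn nx]]]]] := cut n0 nL.
  have [e _] := alph_omega A; have [p np] := ends_in_one g (e 0%N).
  exists g, (e 0%N), p, 0; split=> //.
    rewrite lexx /= lt_neqAle L_nonneg andbT.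
    by apply/eqP => E; apply: (@L_letter_neq0 (e 0%N, p)).
  rewrite triple_vertex //; apply/(pt_eq (valid_L g) vn).
  by rewrite ng (c_prefix Lh).
exists g, a, p, (n - L g); split.
- exact/not_ends_inP.
- apply/andP; split; first by rewrite Zsub_ge0 ltW.
  by apply: (Zlt_lin1 nx); zeq.
have E : L g + (n - L g) = n by zeq.
rewrite /triple E; apply/pt_eq => //.
  by rewrite /valid n0 Lx ltW.
by rewrite (c_prefix Lhx) Lx ltW.
Qed.

Lemma act_vertex u g : act u (vertex g) = vertex (u * g)%g.
Proof. by rewrite act_pt ?valid_L // -(bf_distMr u g) geo_end. Qed.

(** Both the length and the distance from [u] grow by [L x] from [k] to [h], so [c u h = c u k]: the
    translated edge lies on the climbing leg. *)
Lemma act_triple_right u g x t :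
    ~ ends_in g (linv x) -> 0 <= t < L (bf_letter x) -> 0 < t ->
    ~ ends_in (u * g)%g (linv x) ->
  act u (triple g x t) = triple (u * g)%g x t.
Proof.
move=> ng tx t0 nug; rewrite act_pt; last exact: triple_valid.
rewrite /triple mulgA; set k := (u * g)%g; set h := (k * _)%g.
have Lg := L_not_ends_in ng; have Lk := L_not_ends_in nug; rewrite -/k -/h in Lk.
have D1 : bf_dist u k = L g by rewrite bf_distMr.
have D2 : bf_dist u h = L g + L (bf_letter x) by rewrite /h /k -mulgA bf_distMr.
have E1 := bf_dist_c u k; have E2 := bf_dist_c u h; clearbody k h.
have cE : c u h = c u k by zeq.
rewrite geo_right; first by congr pt; zeq.
by apply: (Zlt_lin2 t0 (c_leR u k)); zeq.
Qed.

Lemma act_triple_left u g x t :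
    ~ ends_in g (linv x) -> 0 <= t < L (bf_letter x) -> 0 < t ->
    ends_in (u * g)%g (linv x) ->
  ~ ends_in (u * g * bf_letter x)%g x /\
  act u (triple g x t) =
    triple (u * g * bf_letter x)%g (linv x) (L (bf_letter x) - t).
Proof.
move=> ng tx t0 /ends_inP; set k := (u * g)%g; set h := (k * bf_letter x)%g => Lk.
have Lx : L (bf_letter (linv x)) = L (bf_letter x) by rewrite L_letterE [RHS]L_letterE.
have kE : (h * bf_letter (linv x))%g = k by rewrite bf_letterV mulgK.
have nh : ~ ends_in h (linv (linv x)) by apply/not_ends_inP; rewrite kE Lx.
split; first by rewrite linvK in nh.
rewrite act_pt; last exact: triple_valid.
rewrite /triple kE mulgA -/k -/h.
have Lg := L_not_ends_in ng; have chk : c h k = L h by rewrite -kE c_mulr // kE Lx.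
have D1 : bf_dist u k = L g by rewrite bf_distMr.
have D2 : bf_dist u h = L g + L (bf_letter x) by rewrite /h /k -mulgA bf_distMr.
have v := triple_valid nh; rewrite kE Lx in v.
have E1 := bf_dist_c u k; have E2 := bf_dist_c u h; clearbody k h.
have /andP[_ tx'] := tx.
have cE : c u h + L (bf_letter x) = c u k by zeq.
(* Otherwise [c u h] would be less than both [c u k] and [c k h], against the strict isosceles
   inequality. So [h] is a prefix of [u], the path from [u] to [h] only descends, and the edge is
   measured from its other end. *)
have Lh : L h = c u h.
  apply: le_anti; rewrite c_leR andbT leNgt; apply/negP => lt.
  have lt2 : c u h < c u k by apply: (Zlt_lin1 (lt_trans t0 tx')); zeq.
  have lt3 : c u h < c k h by rewrite (c_sym k) chk.
  by have := c_isosceles_lt lt2 lt3; rewrite ltxx.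
have le : L (bf_letter x) - t < L (bf_letter x) by apply: (Zlt_lin1 t0); zeq.
have le0 : 0 <= L (bf_letter x) - t by rewrite Zsub_ge0 ltW.
rewrite geo_left; last by apply: (Zle_lin1 le0); zeq.
have E : L u - (L g + t) = L h + (L (bf_letter x) - t) by zeq.
rewrite E; apply/pt_eq.
- apply/andP; split; first by apply: Zaddr_ge0 le0; apply: L_nonneg.
  by apply: (Zle_lin2 (ltW t0) (c_leL u k)); zeq.
- by apply: v; rewrite le0 le.
- by split=> //; apply: (Zle_lin1 (ltW t0)); zeq.
Qed.

End Points.

Theorem mainTheorem4 (A : omegaAlphabet) :
  (* a triple represents an element, and for t = 0 this is the vertex w *)
  (forall (w : BF A) (a : A) (p : bool) (t : Zomega A),
     is_triple w (a, p) t ->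
     0 <= L w + t <= L (w * bf_letter (a, p))%g /\
     (t = 0 -> triple w (a, p) t = vertex w)) /\
  (* existence *)
  (forall x : tree A,
     exists (w : BF A) (a : A) (p : bool) (t : Zomega A),
       is_triple w (a, p) t /\ triple w (a, p) t = x) /\
  (* uniqueness, the second coordinate being dropped when t = 0 *)
  (forall (w w' : BF A) (a a' : A) (p p' : bool) (t t' : Zomega A),
     is_triple w (a, p) t -> is_triple w' (a', p') t' ->
     triple w (a, p) t = triple w' (a', p') t' ->
     [/\ w = w', t = t' & t <> 0 -> (a, p) = (a', p')]) /\
  (* the action *)
  (forall u w : BF A, act u (vertex w) = vertex (u * w)%g) /\
  (forall (u w : BF A) (a : A) (p : bool) (t : Zomega A),
     is_triple w (a, p) t -> 0 < t ->
     (~ ends_in (u * w)%g (a, ~~ p) ->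
        is_triple (u * w)%g (a, p) t /\
        act u (triple w (a, p) t) = triple (u * w)%g (a, p) t) /\
     (ends_in (u * w)%g (a, ~~ p) ->
        is_triple (u * w * bf_letter (a, p))%g (a, ~~ p)
          (L (bf_letter (a, false)) - t) /\
        act u (triple w (a, p) t) =
          triple (u * w * bf_letter (a, p))%g (a, ~~ p)
            (L (bf_letter (a, false)) - t))).
Proof.
have L_pos (a : A) p : L (bf_letter (a, false)) = L (bf_letter (a, p)).
  by rewrite [RHS]L_letterE.
split=> [w a p t [t_lt nw]|].
  rewrite (L_pos _ p) in t_lt; split; first exact: triple_valid.
  by move=> ->; apply: triple_vertex.
split=> [x|].
  have [w [a [p [t [nw t_lt <-]]]]] := triple_exists x.
  by exists w, a, p, t; rewrite /is_triple (L_pos _ p).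
split=> [w w' a a' p p' t t' [t_lt nw] [t'_lt nw']|].
  by apply: triple_inj; rewrite -?L_pos.
split=> [u w|u w a p t [t_lt nw] t_gt0]; first exact: act_vertex.
have t_lt' := t_lt; rewrite (L_pos _ p) in t_lt'; split=> uw.
  by split=> //; apply: act_triple_right.
have [nv ->] := act_triple_left nw t_lt' t_gt0 uw.
rewrite (L_pos _ p); split=> //; split; last by rewrite /linv /= negbK.
have /andP[t0 tx] := t_lt'.
rewrite Zsub_ge0 (ltW tx) /= (L_pos _ p).
by apply: (Zlt_lin1 t_gt0); zeq.
Qed.
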